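(* There is a short exact sequence of sheaves of $A$-modules on $X$ $$0 \longrightarrow \mathcal{O}_X \otimes A \overset{\partial}{\longrightarrow} \mathcal{O}_X(\infty) \otimes A \longrightarrow C \longrightarrow 0$$ where $$\partial\colon f\otimes a \mapsto f\otimes ta - (tf+f^q)\otimes a .$$
   Context: Let $k$ be a finite field with $q$ elements; schemes are over $\operatorname{Spec} k$ and $\otimes$ means $\otimes_k$. Let $t$ be the standard coordinate on $\mathbf{P}^1$ over $k$, $F=k(t)$, and $A=k[t]$ the ring of functions regular away from the point $\infty\in\mathbf{P}^1$. Let $X$ be a smooth projective geometrically connected curve over $k$ with a surjective map $X\to\mathbf{P}^1$, with function field $K$, and let $Y\subset X$ be the inverse image of $\operatorname{Spec} A=\mathbf{P}^1-\infty$. The element $t$ is viewed in $K$ via $X\to \mathbf{P}^1$. For a (closed) point $z\in X\setminus Y$, $K_z$ denotes the completion of $K$ at $z$. $\mathcal{O}_{\mathbf{P}^1}(n\infty)$ is the sheaf of functions on $\mathbf{P}^1$ with a pole of order at most $n$ at $\infty$, and $\mathcal{O}_X(n\infty)$ is its pullback along $X\to\mathbf{P}^1$. The sheaves $\mathcal{O}_X\otimes A$ and $\mathcal{O}_X(\infty)\otimes A$ are sheaves of $A$-modules on $X$ via the second factor. The Carlitz module is the functor $C_0$ from $\operatorname{Spec} A$-schemes to $A$-modules with $C_0(S)=\Gamma(S,\mathcal{O}_S)$ as a $k$-vector space, with $A$-module structure given by the $k$-algebra homomorphism $\phi\colon A\to\operatorname{End}_k\Gamma(S,\mathcal{O}_S)$,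 $t\mapsto (c\mapsto tc+c^q)$. For an $A$-algebra $R$ write $C_0(R)=C_0(\operatorname{Spec} R)$. The Carlitz exponential is the unique power series $\exp x = x+e_1x^q+e_2x^{q^2}+\cdots\in F[[x]]$ satisfying $\exp(tx)=t\exp x+(\exp x)^q$. It is entire and defines for each $z\in X\setminus Y$ an $A$-linear map $\exp\colon K_z\to C_0(K_z)$ (where $K_z$ on the left has its usual $A$-module structure by multiplication). The sheaf $C$ of $A$-modules on $X$ (Zariski topology) is defined by $$C(U)=\Big\{(c,(\gamma_z)_z)\in C_0(U\cap Y)\times\prod_{z\in U\setminus Y}K_z \ \Big|\ \forall z,\ \exp\gamma_z=c\Big\},$$ where the equality $\exp \gamma_z=c$ is in $C_0(K_z)$; the $A$-module structure is induced from that of $C_0(U\cap Y)$ and the usual one on $K_z$. *)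

(* Defs.v *)
From HB Require Import structures.
From mathcomp Require Import all_boot all_order all_algebra all_field.
From mathcomp Require Import all_classical all_reals.
From mathcomp Require Import topology.
From mathcomp Require abelian.

Set Implicit Arguments.
Unset Strict Implicit.
Unset Printing Implicit Defensive.

Import Order.TTheory GRing.Theory Num.Theory.

Local Open Scope classical_set_scope.
Local Open Scope ring_scope.

Section Modules.

Definition restr_scalars (A L : comNzRingType) (f : {rmorphism A -> L}) : Type :=
  L.

Section RestrScalars.
Variables (A L : comNzRingType) (f : {rmorphism A -> L}).
Local Notation M := (restr_scalars f).

HB.instance Definition _ := GRing.Zmodule.copy M L.

Definition rs_scale (a : A) (x : M) : M := f a * (x : L).

Fact rs_scaleA a b x : rs_scale a (rs_scale b x) = rs_scale (a * b) x.
Proof. by rewrite /rs_scale mulrA rmorphM. Qed.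
Fact rs_scale1 : left_id 1 rs_scale.
Proof. by move=> x; rewrite /rs_scale rmorph1 mul1r. Qed.
Fact rs_scaleDr : right_distributive rs_scale +%R.
Proof. by move=> a x y; rewrite /rs_scale mulrDr. Qed.
Fact rs_scaleDl x : {morph rs_scale^~ x : a b / a + b}.
Proof. by move=> a b; rewrite /rs_scale rmorphD mulrDl. Qed.

HB.instance Definition _ := GRing.Zmodule_isLmodule.Build A M
  rs_scaleA rs_scale1 rs_scaleDr rs_scaleDl.

End RestrScalars.

Definition dprod (A : pzRingType) (I : Type) (M : I -> lmodType A) : Type :=
  forall i, M i.

Section DProd.
Variables (A : pzRingType) (I : Type) (M : I -> lmodType A).
Local Notation P := (dprod M).

HB.instance Definition _ := gen_eqMixin P.
HB.instance Definition _ := gen_choiceMixin P.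

Definition dp_zero : P := fun i => 0.
Definition dp_opp (u : P) : P := fun i => - u i.
Definition dp_add (u v : P) : P := fun i => u i + v i.
Definition dp_scale (a : A) (u : P) : P := fun i => a *: u i.

Fact dp_addA : associative dp_add.
Proof. by move=> u v w; apply: functional_extensionality_dep => i; exact: addrA. Qed.
Fact dp_addC : commutative dp_add.
Proof. by move=> u v; apply: functional_extensionality_dep => i; exact: addrC. Qed.
Fact dp_add0 : left_id dp_zero dp_add.
Proof. by move=> u; apply: functional_extensionality_dep => i; exact: add0r. Qed.
Fact dp_addN : left_inverse dp_zero dp_opp dp_add.
Proof. by move=> u; apply: functional_extensionality_dep => i; exact: addNr. Qed.

HB.instance Definition _ :=
  GRing.isZmodule.Build P dp_addA dp_addC dp_add0 dp_addN.

Fact dp_scaleA a b u : dp_scale a (dp_scale b u) = dp_scale (a * b) u.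
Proof. by apply: functional_extensionality_dep => i; exact: scalerA. Qed.
Fact dp_scale1 : left_id 1 dp_scale.
Proof. by move=> u; apply: functional_extensionality_dep => i; exact: scale1r. Qed.
Fact dp_scaleDr : right_distributive dp_scale +%R.
Proof. by move=> a u v; apply: functional_extensionality_dep => i; exact: scalerDr. Qed.
Fact dp_scaleDl u : {morph dp_scale^~ u : a b / a + b}.
Proof. by move=> a b; apply: functional_extensionality_dep => i; exact: scalerDl. Qed.

HB.instance Definition _ := GRing.Zmodule_isLmodule.Build A P
  dp_scaleA dp_scale1 dp_scaleDr dp_scaleDl.

End DProd.

Record submodule (A : pzRingType) (V : lmodType A) := Submodule {
  sm_set :> V -> Prop;
  sm_0 : sm_set 0;
  sm_lin : forall a u v, sm_set u -> sm_set v -> sm_set (a *: u + v) }.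

Record submod_type (A : pzRingType) (V : lmodType A) (P : submodule V) : Type :=
  SubmodElt { sm_val : V; sm_valP : P sm_val }.

Section SubmodType.
Variables (A : pzRingType) (V : lmodType A) (P : submodule V).
Local Notation S := (submod_type P).

HB.instance Definition _ := gen_eqMixin S.
HB.instance Definition _ := gen_choiceMixin S.

Lemma sm_val_inj : injective (@sm_val A V P).
Proof.
move=> [u uP] [v vP] /= uv; rewrite {u}uv in uP *.
by congr SubmodElt; exact: Prop_irrelevance.
Qed.

Fact sm_addP u v : P u -> P v -> P (u + v).
Proof. by move=> Pu Pv; rewrite -[u]scale1r; exact: sm_lin. Qed.
Fact sm_scaleP a u : P u -> P (a *: u).
Proof. by move=> Pu; rewrite -[_ *: _]addr0; apply: sm_lin => //; exact: sm_0. Qed.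
Fact sm_oppP u : P u -> P (- u).
Proof. by move=> Pu; rewrite -scaleN1r; exact: sm_scaleP. Qed.

Definition sm_zero : S := SubmodElt (sm_0 P).
Definition sm_opp (u : S) : S := SubmodElt (sm_oppP (sm_valP u)).
Definition sm_add (u v : S) : S := SubmodElt (sm_addP (sm_valP u) (sm_valP v)).
Definition sm_scale (a : A) (u : S) : S := SubmodElt (sm_scaleP a (sm_valP u)).

Fact sm_addA : associative sm_add.
Proof. by move=> u v w; apply: sm_val_inj; exact: addrA. Qed.
Fact sm_addC : commutative sm_add.
Proof. by move=> u v; apply: sm_val_inj; exact: addrC. Qed.
Fact sm_add0 : left_id sm_zero sm_add.
Proof. by move=> u; apply: sm_val_inj; exact: add0r. Qed.
Fact sm_addN : left_inverse sm_zero sm_opp sm_add.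
Proof. by move=> u; apply: sm_val_inj; exact: addNr. Qed.

HB.instance Definition _ :=
  GRing.isZmodule.Build S sm_addA sm_addC sm_add0 sm_addN.

Fact sm_scaleA a b u : sm_scale a (sm_scale b u) = sm_scale (a * b) u.
Proof. by apply: sm_val_inj; exact: scalerA. Qed.
Fact sm_scale1 : left_id 1 sm_scale.
Proof. by move=> u; apply: sm_val_inj; exact: scale1r. Qed.
Fact sm_scaleDr : right_distributive sm_scale +%R.
Proof. by move=> a u v; apply: sm_val_inj; exact: scalerDr. Qed.
Fact sm_scaleDl u : {morph sm_scale^~ u : a b / a + b}.
Proof. by move=> a b; apply: sm_val_inj; exact: scalerDl. Qed.

HB.instance Definition _ := GRing.Zmodule_isLmodule.Build A S
  sm_scaleA sm_scale1 sm_scaleDr sm_scaleDl.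

End SubmodType.

End Modules.

Section Sheaves.

Record opens (X : topologicalType) := Opens {
  oset :> set X;
  osetP : open oset }.

Record sheaf (A : pzRingType) (X : topologicalType) := Sheaf {
  sections :> opens X -> lmodType A;
  res : forall U V : opens X, V `<=` U -> {linear sections U -> sections V};
  res_id : forall (U : opens X) (UU : U `<=` U) s, res UU s = s;
  res_comp : forall (U V W : opens X) (VU : V `<=` U) (WV : W `<=` V)
    (WU : W `<=` U) s, res WV (res VU s) = res WU s;
  sheaf_sep : forall (U : opens X) (I : Type) (V : I -> opens X)
    (VU : forall i, V i `<=` U), U `<=` \bigcup_i V i ->
    forall s s', (forall i, res (VU i) s = res (VU i) s') -> s = s';
  sheaf_glue : forall (U : opens X) (I : Type) (V : I -> opens X)
    (VU : forall i, V i `<=` U), U `<=` \bigcup_i V i ->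
    forall s : forall i, sections (V i),
    (forall i j (W : opens X) (Wi : W `<=` V i) (Wj : W `<=` V j),
       res Wi (s i) = res Wj (s j)) ->
    exists s0, forall i, res (VU i) s0 = s i }.

Arguments res {A X} F {U V} VU : rename.

Record sheaf_hom (A : pzRingType) (X : topologicalType) (F G : sheaf A X) :=
  SheafHom {
  hom_app :> forall U : opens X, {linear F U -> G U};
  hom_nat : forall (U V : opens X) (VU : V `<=` U) s,
    hom_app V (res F VU s) = res G VU (hom_app U s) }.

Definition locally_in_image (A : pzRingType) (X : topologicalType)
    (F G : sheaf A X) (f : sheaf_hom F G) (U : opens X) (s : G U) : Prop :=
  forall x, oset U x -> exists (V : opens X) (VU : V `<=` U),
    oset V x /\ exists r : F V, f V r = res G VU s.

Definition sheaf_short_exact (A : pzRingType) (X : topologicalType)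
    (F G H : sheaf A X) (f : sheaf_hom F G) (g : sheaf_hom G H) : Prop :=
  [/\ forall U, injective (f U),
      forall U (s : G U), g U s = 0 <-> locally_in_image f s
    & forall U (s : H U), locally_in_image g s].

End Sheaves.

Section Valuations.
Local Open Scope ereal_scope.

(* Normalized discrete valuations; they correspond bijectively to discrete
   valuation rings with fraction field L, through {x | 0 <= v x}. *)
Record is_dval (L : fieldType) (v : L -> \bar int) : Prop := IsDval {
  dval_eq0 : forall x, v x = +oo <-> x = 0%R;
  dvalM : forall x y, v (x * y)%R = v x + v y;
  dvalD : forall x y, Order.min (v x) (v y) <= v (x + y)%R;
  dval_unif : exists x, v x = 1%:E }.

Definition vcvg (L : fieldType) (v : L -> \bar int) (u : nat -> L) (l : L) :=
  forall N : int, exists n0 : nat, forall n, (n0 <= n)%N -> N%:E <= v (u n - l)%R.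

Definition vcauchy (L : fieldType) (v : L -> \bar int) (u : nat -> L) :=
  forall N : int, exists n0 : nat, forall m n, (n0 <= m)%N -> (n0 <= n)%N ->
    N%:E <= v (u m - u n)%R.

Record completion (K : fieldType) (v : K -> \bar int) := Completion {
  cfield :> fieldType;
  cval : cfield -> \bar int;
  cemb : {rmorphism K -> cfield};
  cval_dval : is_dval cval;
  cval_emb : forall x, cval (cemb x) = v x;
  cemb_dense : forall (y : cfield) (N : int), exists x,
    N%:E <= cval (y - cemb x)%R;
  cfield_complete : forall u, vcauchy cval u -> exists l, vcvg cval u l }.

End Valuations.

Section DvalTheory.
Variables (L : fieldType) (v : L -> \bar int) (vP : is_dval v).
Local Open Scope ereal_scope.

Lemma dval0 : v 0%R = +oo.
Proof. exact/(dval_eq0 vP). Qed.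

Lemma dval_ge0D x y (N : \bar int) : N <= v x -> N <= v y -> N <= v (x + y)%R.
Proof.
by move=> Nx Ny; apply: le_trans (dvalD vP x y); rewrite le_min Nx Ny.
Qed.

Lemma dval_fin x : x != 0%R -> exists n : int, v x = n%:E.
Proof.
have [u vu] := dval_unif vP.
have vM := dvalM vP.
move=> x0; case vx: (v x) => [n| |]; first by exists n.
  by move/(dval_eq0 vP): vx x0 => ->; rewrite eqxx.
by have := vM x (x^-1 * u)%R; rewrite mulVKf // vu vx; case: (v _).
Qed.

Lemma dval1E : v 1%R = 0.
Proof.
have [n vn] := dval_fin (oner_neq0 L).
have := dvalM vP 1%R 1%R; rewrite mulr1 vn -EFinD => -[] /esym/eqP.
by rewrite -subr_eq0 addrK => /eqP ->.
Qed.

Lemma dval_ge0M x y : 0 <= v x -> 0 <= v y -> 0 <= v (x * y)%R.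
Proof. by move=> x0 y0; rewrite (dvalM vP); exact: adde_ge0. Qed.

Lemma dval_ge0X x n : 0 <= v x -> 0 <= v (x ^+ n)%R.
Proof.
move=> x0; elim: n => [|n IHn]; first by rewrite expr0 dval1E.
by rewrite exprS; exact: dval_ge0M.
Qed.

Lemma dval_leMl c x N : 0 <= v c -> N <= v x -> N <= v (c * x)%R.
Proof. by move=> c0 Nx; rewrite (dvalM vP) -[N]add0e leeD. Qed.

End DvalTheory.

Section Carlitz.
Variable k : finFieldType.

Definition ratfun : fieldType := {fraction {poly k}}.

Definition ratfun_t : ratfun := FracField.tofrac 'X.

Lemma card_gt1 : (1 < #|k|)%N.
Proof. exact: finNzRing_gt1. Qed.

(* C_0(Spec R), for the A-algebra R with structure map alg. *)
Definition carlitz (R : comNzRingType) (alg : {rmorphism {poly k} -> R}) : Type :=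
  R.

Section Functor.
Variables (R : comNzRingType) (alg : {rmorphism {poly k} -> R}).

Definition carlitz_t (c : R) : R := alg 'X * c + c ^+ #|k|.

Definition carlitz_act (a : {poly k}) (c : R) : R :=
  \sum_(i < size a) alg (a`_i)%:P * iter i carlitz_t c.


Lemma frobD (x y : R) n :
  (x + y) ^+ (#|k| ^ n) = x ^+ (#|k| ^ n) + y ^+ (#|k| ^ n).
Proof.
have [p pr_p chkp] := finPcharP k.
have chRp : p \in [pchar R].
  exact: (rmorph_pchar (alg \o @polyC k)).
have kp : p.-nat #|k|.
  by rewrite -cardsT; apply: abelian.abelem_pgroup (abelian.fin_ring_pchar_abelem chkp).
apply: exprDn_pchar; rewrite pnatX; apply/orP; left.
by apply: sub_in_pnat kp => r _; rewrite inE => /eqP ->.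
Qed.

Lemma frob_const (c : k) (x : R) n :
  (alg c%:P * x) ^+ (#|k| ^ n) = alg c%:P * x ^+ (#|k| ^ n).
Proof.
rewrite exprMn -rmorphXn -polyC_exp; congr (alg _%:P * _).
by elim: n => [|n IHn]; rewrite ?expr1 // expnSr exprM IHn expf_card.
Qed.

Lemma carlitz_tD x y : carlitz_t (x + y) = carlitz_t x + carlitz_t y.
Proof. by rewrite /carlitz_t mulrDr -(expn1 #|k|) frobD addrACA. Qed.

Lemma carlitz_tZ c x : carlitz_t (alg c%:P * x) = alg c%:P * carlitz_t x.
Proof. by rewrite /carlitz_t -(expn1 #|k|) frob_const mulrDr mulrCA. Qed.

Lemma carlitz_t0 : carlitz_t 0 = 0.
Proof. by rewrite -[in LHS](mul0r 0) -(rmorph0 alg) -polyC0 carlitz_tZ polyC0 rmorph0 mul0r. Qed.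

Lemma carlitz_t_sum N (f : nat -> R) :
  carlitz_t (\sum_(i < N) f i) = \sum_(i < N) carlitz_t (f i).
Proof.
by elim: N => [|N IHN]; rewrite ?big_ord0 ?carlitz_t0 // !big_ord_recr /= carlitz_tD IHN.
Qed.

Lemma iter_carlitz_tD n x y :
  iter n carlitz_t (x + y) = iter n carlitz_t x + iter n carlitz_t y.
Proof. by elim: n => //= n ->; rewrite carlitz_tD. Qed.

Lemma carlitz_actE N (a : {poly k}) c : (size a <= N)%N ->
  carlitz_act a c = \sum_(i < N) alg (a`_i)%:P * iter i carlitz_t c.
Proof.
move=> aN; rewrite /carlitz_act
  (big_ord_widen N (fun i => alg (a`_i)%:P * iter i carlitz_t c) aN) big_mkcond.
apply: eq_bigr => i _; case: ltnP => // ai.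
by rewrite nth_default // polyC0 rmorph0 mul0r.
Qed.

Lemma carlitz_actDl a b c :
  carlitz_act (a + b) c = carlitz_act a c + carlitz_act b c.
Proof.
pose N := maxn (size a) (size b).
rewrite !(@carlitz_actE N) ?leq_maxl ?leq_maxr ?size_polyD //.
rewrite -big_split; apply: eq_bigr => i _ /=.
by rewrite coefD polyCD rmorphD mulrDl.
Qed.

Lemma carlitz_actDr a c d :
  carlitz_act a (c + d) = carlitz_act a c + carlitz_act a d.
Proof.
rewrite /carlitz_act -big_split; apply: eq_bigr => i _ /=.
by rewrite iter_carlitz_tD mulrDr.
Qed.

Lemma carlitz_actC b c : carlitz_act b%:P c = alg b%:P * c.
Proof.
rewrite (@carlitz_actE 1) ?size_polyC; last by case: (_ == _).
by rewrite big_ord1 coefC.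
Qed.

Lemma carlitz_act_const b a c :
  carlitz_act (b%:P * a) c = alg b%:P * carlitz_act a c.
Proof.
rewrite (@carlitz_actE (size a)); last by rewrite mul_polyC size_scale_leq.
rewrite /carlitz_act mulr_sumr; apply: eq_bigr => i _.
by rewrite coefCM polyCM rmorphM mulrA.
Qed.

Lemma carlitz_actMX a c : carlitz_act (a * 'X) c = carlitz_t (carlitz_act a c).
Proof.
rewrite (@carlitz_actE (size a).+1); last first.
  by case: (eqVneq a 0) => [->|a0]; rewrite ?mul0r ?size_poly0 // size_mulX.
rewrite big_ord_recl coefMX eqxx polyC0 rmorph0 mul0r add0r.
rewrite /carlitz_act (carlitz_t_sum _ (fun i => alg (a`_i)%:P * iter i carlitz_t c)).
by apply: eq_bigr => i _; rewrite coefMX /= carlitz_tZ.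
Qed.

Lemma carlitz_actM a b c :
  carlitz_act a (carlitz_act b c) = carlitz_act (a * b) c.
Proof.
elim/poly_ind: a => [|a e IHa].
  by rewrite mul0r -polyC0 !carlitz_actC !rmorph0 !mul0r.
rewrite carlitz_actDl carlitz_actMX carlitz_actC IHa mulrDl carlitz_actDl.
by rewrite carlitz_act_const mulrAC carlitz_actMX.
Qed.

Lemma carlitz_act1 : left_id 1 carlitz_act.
Proof. by move=> c; rewrite -polyC1 carlitz_actC polyC1 rmorph1 mul1r. Qed.

HB.instance Definition _ := GRing.Zmodule.copy (carlitz alg) R.
HB.instance Definition _ := GRing.Zmodule_isLmodule.Build {poly k} (carlitz alg)
  carlitz_actM carlitz_act1 carlitz_actDr (fun c a b => carlitz_actDl a b c).

End Functor.

Lemma carlitz_act_morph (R S : comNzRingType) (alg : {rmorphism {poly k} -> R})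
    (f : {rmorphism R -> S}) (a : {poly k}) (c : R) :
  f (carlitz_act alg a c) = carlitz_act (f \o alg) a (f c).
Proof.
rewrite rmorph_sum; apply: eq_bigr => i _; rewrite rmorphM; congr (_ * _).
by elim: (i : nat) => //= n <-; rewrite /carlitz_t rmorphD rmorphM rmorphXn.
Qed.

(* Coefficients of the Carlitz exponential exp x = \sum_i (exp_coef i) x^(q^i). *)
Fixpoint exp_coef (i : nat) : ratfun :=
  if i is j.+1 then
    exp_coef j ^+ #|k| / (ratfun_t ^+ (#|k| ^ i) - ratfun_t)
  else 1.

Definition exp_trunc (e : nat -> ratfun) (n : nat) : {poly ratfun} :=
  \sum_(i < n) e i *: 'X^(#|k| ^ i).

Lemma ratfun_tX_neq i : ratfun_t ^+ (#|k| ^ i.+1) - ratfun_t != 0.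
Proof.
rewrite /ratfun_t -tofracXn -tofracB tofrac_eq0 subr_eq0.
apply/eqP => /(congr1 (size \o @polyseq k)) /=.
rewrite size_polyXn size_polyX => -[] /eqP.
by rewrite -[X in _ == X](expn0 #|k|) (eqn_exp2l _ _ card_gt1).
Qed.

Lemma exp_coefS i :
  exp_coef i.+1 * ratfun_t ^+ (#|k| ^ i.+1)
  = ratfun_t * exp_coef i.+1 + exp_coef i ^+ #|k|.
Proof.
have := divfK (ratfun_tX_neq i) (exp_coef i ^+ #|k|).
rewrite -[_ / _]/(exp_coef i.+1) mulrBr => <-.
by rewrite [ratfun_t * _]mulrC addrC subrK.
Qed.

Arguments exp_coef : simpl never.

Lemma exp_trunc_eqE (e : nat -> ratfun) :
  (forall n, exp_trunc e n.+1 \Po (ratfun_t *: 'X)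
    = ratfun_t *: exp_trunc e n.+1 + exp_trunc e n ^+ #|k|) <->
  (forall i, e i.+1 * ratfun_t ^+ (#|k| ^ i.+1) = ratfun_t * e i.+1 + e i ^+ #|k|).
Proof.
pose d i := e i.+1 * ratfun_t ^+ (#|k| ^ i.+1) - (ratfun_t * e i.+1 + e i ^+ #|k|).
have frob_sum n : exp_trunc e n ^+ #|k| = \sum_(i < n) e i ^+ #|k| *: 'X^(#|k| ^ i.+1).
  pose alg : {rmorphism {poly k} -> {poly ratfun}} := polyC \o @FracField.tofrac _.
  rewrite /exp_trunc; elim: n => [|n IHn].
    by rewrite !big_ord0 expr0n eqn0Ngt (ltnW card_gt1).
  rewrite !big_ord_recr /= -[in LHS](expn1 #|k|) (frobD alg) !expn1 IHn.
  by rewrite exprZn -exprM expnSr.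
have dE n : exp_trunc e n.+1 \Po (ratfun_t *: 'X)
    - (ratfun_t *: exp_trunc e n.+1 + exp_trunc e n ^+ #|k|)
    = \sum_(i < n) d i *: 'X^(#|k| ^ i.+1).
  rewrite frob_sum /exp_trunc linear_sum /= scaler_sumr !big_ord_recl /=.
  rewrite !expn0 expr1 !linearZ /= comp_polyX -[X in _ - X]addrA opprD addrACA.
  rewrite subrr add0r -big_split -sumrB /=; apply: eq_bigr => i _.
  by rewrite comp_polyZ comp_Xn_poly exprZn !scalerA -scalerDl -scalerBl.
split=> [He i|He n].
  have D m : \sum_(j < m) d j *: 'X^(#|k| ^ j.+1) = 0 :> {poly ratfun}.
    by rewrite -dE He subrr.
  apply/eqP; rewrite -subr_eq0 -/(d i); apply/eqP.
  have := D i.+1; rewrite big_ord_recr /= D add0r => /(congr1 (fun p : {poly ratfun} => p`_(#|k| ^ i.+1))).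
  by rewrite coefZ coefXn eqxx mulr1 coef0.
apply/eqP; rewrite -subr_eq0 dE big1 // => i _.
by rewrite /d He subrr scale0r.
Qed.

(* exp_functional and exp_unique: exp_coef is the unique sequence e with e_0 = 1
   such that exp x = \sum_i e_i x^(q^i) satisfies exp(tx) = t exp x + (exp x)^q
   in F[[x]]; the equation is expressed through truncations of the series. *)
Lemma exp_functional n : exp_trunc exp_coef n.+1 \Po (ratfun_t *: 'X)
  = ratfun_t *: exp_trunc exp_coef n.+1 + exp_trunc exp_coef n ^+ #|k|.
Proof. exact: (exp_trunc_eqE _).2 exp_coefS n. Qed.

Lemma exp_unique (e : nat -> ratfun) : e 0%N = 1 ->
  (forall n, exp_trunc e n.+1 \Po (ratfun_t *: 'X)
     = ratfun_t *: exp_trunc e n.+1 + exp_trunc e n ^+ #|k|) ->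
  e =1 exp_coef.
Proof.
move=> e0 /exp_trunc_eqE eS; elim=> [//|i IHi].
have eB (f : nat -> ratfun) :
    f i.+1 * ratfun_t ^+ (#|k| ^ i.+1) = ratfun_t * f i.+1 + f i ^+ #|k| ->
    f i.+1 * (ratfun_t ^+ (#|k| ^ i.+1) - ratfun_t) = f i ^+ #|k|.
  by move=> fS; rewrite mulrBr fS [f i.+1 * _]mulrC [X in X - _]addrC addrK.
apply: (mulIf (ratfun_tX_neq i)); rewrite (eB e (eS i)) IHi.
exact/esym/(eB _ (exp_coefS i)).
Qed.

End Carlitz.

Arguments carlitz {k R} alg.

(* The curve X is encoded by its function field K, a finite extension of
   F = k(t); the extension structure is the surjective map X -> P^1. As X is
   smooth and projective, its points are the generic point, with local ring K,
   and the closed points, whose local rings are all the discrete valuation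
   rings of K containing k; nonempty opens are the complements of finite sets
   of closed points, and a section over a nonempty open is an element of K
   subject to conditions at the closed points of this open. *)
Section Curve.
Variables (k : finFieldType) (K : fieldExtType (ratfun k)).

Definition AtoK (a : {poly k}) : K := in_alg K (FracField.tofrac a).

HB.instance Definition _ := GRing.RMorphism.copy AtoK
  (GRing.in_alg K \o @FracField.tofrac {poly k}).

Definition tK : K := AtoK 'X.

Lemma tK_ratfun : tK = in_alg K (ratfun_t k).
Proof. by []. Qed.

(* K is the function field of a smooth projective curve over the perfect field
   k: this curve is geometrically connected iff k is algebraically closed in K. *)
Definition geometrically_connected : Prop :=
  forall x : K, algebraicOver (fun c : k => AtoK c%:P) x ->
    exists c : k, x = AtoK c%:P.

(* Closed points of X. *)
Record place := Place {
  ord :> K -> \bar int;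
  ord_dval : is_dval ord;
  ord_const : forall c : k, (0 <= ord (AtoK c%:P))%E }.

Variant curve : Type := Generic | ClosedPt of place.

HB.instance Definition _ := gen_eqMixin curve.
HB.instance Definition _ := gen_choiceMixin curve.

Definition curve_open (U : set curve) : Prop :=
  U = set0 \/ U Generic /\ finite_set (~` U).

Fact curve_openT : curve_open setT.
Proof. by right; split; rewrite // setCT. Qed.

Fact curve_openI : setI_closed curve_open.
Proof.
move=> U V [->|[UG Uf]]; first by rewrite set0I; left.
move=> [->|[VG Vf]]; first by rewrite setI0; left.
by right; split => //; rewrite setCI finite_setU.
Qed.

Fact curve_open_bigU (I : Type) (f : I -> set curve) :
  (forall i, curve_open (f i)) -> curve_open (\bigcup_i f i).
Proof.
move=> fo; have [[i fi0]|f0] := pselect (exists i, f i !=set0); last first.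
  left; rewrite -subset0 => x [i _ fix_]; apply: f0.
  by exists i, x.
have [fiE|[fiG fif]] := fo i; first by case: fi0 => x; rewrite fiE.
right; split; first by exists i.
apply: sub_finite_set fif => x nx fix_; apply: nx.
by exists i.
Qed.

HB.instance Definition _ := isOpenTopological.Build curve
  curve_openT curve_openI curve_open_bigU.

Lemma open_curveE (U : set curve) : open U = curve_open U.
Proof. by []. Qed.

Lemma open_generic (U : opens curve) x : oset U x -> oset U Generic.
Proof.
case: U => U /= oU Ux; have : curve_open U by rewrite -open_curveE.
by case=> [U0|[]//]; rewrite U0 in Ux.
Qed.

(* z lies over Spec A iff its local ring contains A. *)
Definition affineY : set curve := [set x | match x with
  | Generic => True
  | ClosedPt z => forall a : {poly k}, (0 <= z (AtoK a))%E
  end].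

(* Sections of O_X(n oo): the pullback of O_{P^1}(n oo) is generated by t^n at
   the points outside Y. The last clause makes sections over set0 vanish. *)
Definition regular_sec (n : nat) (U : set curve) (f : K) : Prop :=
  (forall z, U (ClosedPt z) ->
     (affineY (ClosedPt z) -> (0 <= z f)%E) /\
     (~ affineY (ClosedPt z) -> (0 <= z (f / tK ^+ n)%R)%E)) /\
  (U = set0 -> f = 0).

Lemma regular_sec0 n U : regular_sec n U 0.
Proof.
split=> // z _; rewrite mul0r (dval0 (ord_dval z)).
by split=> _; exact: leey.
Qed.

Lemma regular_secD n U f g :
  regular_sec n U f -> regular_sec n U g -> regular_sec n U (f + g).
Proof.
move=> [fU f0] [gU g0]; split=> [z zU|U0]; last by rewrite f0 // g0 // addr0.
have zP := ord_dval z; have [f1 f2] := fU _ zU; have [g1 g2] := gU _ zU.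
by split=> zY; rewrite ?mulrDl; apply: dval_ge0D; auto.
Qed.

Lemma regular_secZ n U c f :
  regular_sec n U f -> regular_sec n U (AtoK c%:P * f).
Proof.
move=> [fU f0]; split=> [z zU|U0]; last by rewrite f0 // mulr0.
have zP := ord_dval z; have [f1 f2] := fU _ zU.
by split=> zY; rewrite -?mulrA; apply: dval_leMl; auto; exact: ord_const.
Qed.

Lemma regular_secM U f g :
  regular_sec 0 U f -> regular_sec 0 U g -> regular_sec 0 U (f * g).
Proof.
move=> [fU f0] [gU g0]; split=> [z zU|U0]; last by rewrite f0 // mul0r.
have zP := ord_dval z; have [f1 f2] := fU _ zU; have [g1 g2] := gU _ zU.
move: f2 g2; rewrite !expr0 !divr1 => f2 g2.
by split=> zY; apply: dval_ge0M; auto.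
Qed.

Lemma regular_sec_sub n (U V : set curve) f : V `<=` U -> V !=set0 ->
  regular_sec n U f -> regular_sec n V f.
Proof.
move=> VU V0 [fU _]; split=> [z /VU /fU//|VE].
by rewrite VE in V0; case: V0.
Qed.

(* Restriction to V of an element of the constant sheaf W. *)
Definition cut (W : nmodType) (V : set curve) (x : W) : W :=
  if `[< V !=set0 >] then x else 0.

Lemma cut_id (W : nmodType) (V : set curve) (x : W) : V !=set0 -> cut V x = x.
Proof. by move=> V0; rewrite /cut asboolT. Qed.

Lemma cut_set0 (W : nmodType) (V : set curve) (x : W) : V = set0 -> cut V x = 0.
Proof. by move=> ->; rewrite /cut asboolF // => -[]. Qed.

Lemma cut_lin (A : pzRingType) (W : lmodType A) V a (x y : W) :
  cut V (a *: x + y) = a *: cut V x + cut V y.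
Proof. by rewrite /cut; case: ifP => _ //; rewrite scaler0 addr0. Qed.

Lemma nonempty_or_set0 (V : set curve) : V !=set0 \/ V = set0.
Proof. by have [->|/set0P] := eqVneq V set0; [right|left]. Qed.

(* K (x) A is {poly K}, with f (x) a = f * a, and A acts through the second
   factor; O_X(n oo)(U) (x) A consists of the polynomials all of whose
   coefficients are in O_X(n oo)(U), see tens_sec_universal. *)
Section Tensor.

Definition polyAtoK : {rmorphism {poly k} -> {poly K}} :=
  map_poly (AtoK \o @polyC k).

Definition KtensA : lmodType {poly k} := restr_scalars polyAtoK.

Definition tens (f : K) (a : {poly k}) : KtensA := f%:P * polyAtoK a.

Definition tw_set n U (p : KtensA) : Prop :=
  forall i, regular_sec n U (p : {poly K})`_i.

Fact tw_set0 n U : tw_set n U 0.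
Proof. by move=> i; rewrite coef0; exact: regular_sec0. Qed.

Fact tw_set_lin n U a p q : tw_set n U p -> tw_set n U q ->
  tw_set n U (a *: p + q).
Proof.
move=> pU qU i; rewrite coefD; apply: regular_secD => //.
rewrite coefM; elim/big_ind : _ => [|f g|j _]; first exact: regular_sec0.
- exact: regular_secD.
- by rewrite coef_map; exact: regular_secZ.
Qed.

Definition tw_mod n U : submodule KtensA := Submodule (tw_set0 n U) (@tw_set_lin n U).

Definition tw_sec n (U : opens curve) : lmodType {poly k} := submod_type (tw_mod n U).

Fact tens_subproof n U f a : regular_sec n U f -> tw_mod n U (tens f a).
Proof.
move=> fU i; rewrite coefCM coef_map mulrC; exact: regular_secZ.
Qed.

Definition tens_sec n (U : opens curve) (f : K) (fU : regular_sec n U f)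
  (a : {poly k}) : tw_sec n U := SubmodElt (tens_subproof a fU).

Lemma tens_sec_sum n (U : opens curve) (s : tw_sec n U) :
  s = \sum_(i < size (sm_val s : {poly K})) tens_sec (sm_valP s i) 'X^i.
Proof.
apply: sm_val_inj; have -> (m : nat) (F : 'I_m -> tw_sec n U) :
    sm_val (\sum_i F i) = \sum_i sm_val (F i).
  by apply: (big_morph (@sm_val _ _ _)).
rewrite /= -[LHS]coefK poly_def; apply: eq_bigr => i _ /=.
by rewrite /tens /polyAtoK /= map_polyXn mul_polyC.
Qed.

Lemma tens_sec_universal n (U : opens curve) (M : zmodType)
    (b : K -> {poly k} -> M) :
  (forall f g a, regular_sec n U f -> regular_sec n U g ->
     b (f + g) a = b f a + b g a) ->
  (forall f a a', regular_sec n U f -> b f (a + a') = b f a + b f a') ->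
  (forall c f a, regular_sec n U f -> b (AtoK c%:P * f) a = b f (c%:P * a)) ->
  exists! h : tw_sec n U -> M, {morph h : s s' / s + s'} /\
    forall f (fU : regular_sec n U f) a, h (tens_sec fU a) = b f a.
Proof.
move=> bDl bDr bZ.
have b0l a : b 0 a = 0.
  apply: (addrI (b 0 a)); rewrite -bDl ?addr0 //; exact: regular_sec0.
have b0r f : regular_sec n U f -> b f 0 = 0.
  by move=> fU; apply: (addrI (b f 0)); rewrite -bDr ?addr0.
pose h (s : tw_sec n U) : M :=
  \sum_(i < size (sm_val s : {poly K})) b (sm_val s : {poly K})`_i 'X^i.
have hE m (s : tw_sec n U) : (size (sm_val s : {poly K}) <= m)%N ->
    h s = \sum_(i < m) b (sm_val s : {poly K})`_i 'X^i.
  move=> sm; rewrite /h (big_ord_widen m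
    (fun i => b (sm_val s : {poly K})`_i 'X^i) sm) big_mkcond.
  by apply: eq_bigr => i _; case: ltnP => // ?; rewrite nth_default // b0l.
have hD : {morph h : s s' / s + s'}.
  move=> s s'; pose m := maxn (size (sm_val s : {poly K})) (size (sm_val s' : {poly K})).
  rewrite !(hE m) ?leq_maxl ?leq_maxr ?size_polyD // -big_split.
  apply: eq_bigr => i _ /=; rewrite coefD bDl //.
    exact: (sm_valP s i).
  exact: (sm_valP s' i).
exists h; split=> [|h' [h'D h'E]].
  split=> // f fU a; rewrite (hE (size a)) /=; last first.
    rewrite /tens mul_polyC (leq_trans (size_scale_leq _ _)) //.
    exact: size_poly.
  have -> : b f a = \sum_(i < size a) b f (a`_i *: 'X^i).
    rewrite -[in LHS](coefK a) poly_def.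
    by apply: (big_morph (b f)) => [x y|]; [exact: bDr|exact: b0r].
  apply: eq_bigr => i _; rewrite /tens coefCM coef_map /= mulrC bZ //.
  by rewrite mul_polyC.
apply: functional_extensionality_dep => s.
have h'0 : h' 0 = 0 by apply: (addrI (h' 0)); rewrite -h'D !addr0.
rewrite [in RHS](tens_sec_sum s) (big_morph h' h'D h'0).
by apply: eq_bigr => i _; rewrite h'E.
Qed.

Fact tw_res_subproof n (U V : opens curve) (VU : V `<=` U) (s : tw_sec n U) :
  tw_mod n V (cut V (sm_val s)).
Proof.
have [V0|V0] := nonempty_or_set0 V; last by rewrite cut_set0 //; exact: tw_set0.
rewrite cut_id // => i; apply: (regular_sec_sub VU V0).
exact: sm_valP s i.
Qed.

Definition tw_res n (U V : opens curve) (VU : V `<=` U) (s : tw_sec n U) :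
  tw_sec n V := SubmodElt (tw_res_subproof VU s).

Arguments tw_res n {U V} VU s.

Fact tw_res_linear n U V VU : linear (@tw_res n U V VU).
Proof. by move=> a x y; apply: sm_val_inj => /=; rewrite -cut_lin. Qed.

HB.instance Definition _ n U V VU := GRing.isLinear.Build {poly k} _ _ _
  (@tw_res n U V VU) (@tw_res_linear n U V VU).


Fact tw_res_id n (U : opens curve) (UU : U `<=` U) s : tw_res n UU s = s.
Proof.
apply: sm_val_inj => /=; have [U0|U0] := nonempty_or_set0 U; first by rewrite cut_id.
rewrite cut_set0 //; apply/polyP => i; rewrite coef0.
by have [_ ->] := sm_valP s i.
Qed.

Fact tw_res_comp n (U V W : opens curve) (VU : V `<=` U) (WV : W `<=` V)
  (WU : W `<=` U) s : tw_res n WV (tw_res n VU s) = tw_res n WU s.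
Proof.
apply: sm_val_inj => /=; have [W0|W0] := nonempty_or_set0 W; last by rewrite !cut_set0.
by rewrite !cut_id //; case: W0 => x /WV; exists x.
Qed.

Fact tw_sheaf_sep n (U : opens curve) (I : Type) (V : I -> opens curve)
  (VU : forall i, V i `<=` U) : U `<=` \bigcup_i V i ->
  forall s s', (forall i, tw_res n (VU i) s = tw_res n (VU i) s') -> s = s'.
Proof.
move=> UV s s' ss'; apply: sm_val_inj; have [[x /UV[i _ Vx]]|U0] := nonempty_or_set0 U.
  have /(congr1 (@sm_val _ _ _)) := ss' i.
  by rewrite /= !cut_id //; exists x.
by apply/polyP => i; have [_ ->//] := sm_valP s i; have [_ ->//] := sm_valP s' i.
Qed.

Fact tw_sheaf_glue n (U : opens curve) (I : Type) (V : I -> opens curve)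
  (VU : forall i, V i `<=` U) : U `<=` \bigcup_i V i ->
  forall s : forall i, tw_sec n (V i),
  (forall i j (W : opens curve) (Wi : W `<=` V i) (Wj : W `<=` V j),
     tw_res n Wi (s i) = tw_res n Wj (s j)) ->
  exists s0, forall i, tw_res n (VU i) s0 = s i.
Proof.
move=> UV s ss; have [U0|U0] := nonempty_or_set0 U; last first.
  exists 0 => i; rewrite linear0; apply: sm_val_inj => /=.
  apply/polyP => j; rewrite coef0; have [_ ->//] := sm_valP (s i) j.
  by rewrite -subset0 -U0; exact: VU.
have [i0 [x0 Vx0]] : exists i, V i !=set0.
  by case: U0 => x /UV[i _ Vx]; exists i, x.
have sE i : V i !=set0 -> sm_val (s i) = sm_val (s i0).
  move=> [x Vx]; pose W := Opens (openI (osetP (V i)) (osetP (V i0))).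
  have /(congr1 (@sm_val _ _ _)) /= := ss i i0 W (@subIsetl _ _ _) (@subIsetr _ _ _).
  by rewrite !cut_id //; exists (Generic); split; apply: open_generic; eassumption.
have s0P : tw_mod n U (sm_val (s i0)).
  move=> j; split=> [z /UV[i _ Vz]|UE]; last by rewrite UE in U0; case: U0.
  rewrite -(sE i); last by exists (ClosedPt z).
  by have [+ _] := sm_valP (s i) j; apply.
exists (SubmodElt s0P) => i; apply: sm_val_inj => /=.
have [V0|V0] := nonempty_or_set0 (V i); first by rewrite cut_id // sE.
rewrite cut_set0 //; apply/polyP => j; rewrite coef0.
by have [_ ->] := sm_valP (s i) j.
Qed.

(* The sheaf O_X(n oo) (x) A. *)
Definition twisted n : sheaf {poly k} curve := @Sheaf {poly k} curve (tw_sec n)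
  (fun U V VU => tw_res n VU) (@tw_res_id n) (@tw_res_comp n) (@tw_sheaf_sep n)
  (@tw_sheaf_glue n).

End Tensor.

Section Exponential.
Variables (z : place) (L : completion z).

Definition AtoL : {rmorphism {poly k} -> L} := cemb L \o AtoK.

Definition exp_partial (g : L) (n : nat) : L :=
  \sum_(i < n) cemb L (in_alg K (exp_coef k i)) * g ^+ (#|k| ^ i).

(* exp g = y. *)
Definition is_exp (g y : L) : Prop := vcvg (@cval K z L) (exp_partial g) y.

Local Notation v := (@cval K z L).
Let vP : is_dval v := cval_dval L.

Lemma AtoL_const_ge0 c : (0 <= v (AtoL c%:P))%E.
Proof. by rewrite cval_emb; exact: ord_const. Qed.

Lemma is_exp0 : is_exp 0 0.
Proof.
move=> N; exists 0%N => n _; rewrite /exp_partial big1 ?subr0 ?(dval0 vP) ?leey //.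
by move=> i _; rewrite expr0n expn_eq0 eqn0Ngt (ltnW (card_gt1 k)) /= mulr0.
Qed.

Lemma exp_partialD g h n :
  exp_partial (g + h) n = exp_partial g n + exp_partial h n.
Proof.
rewrite -big_split; apply: eq_bigr => i _ /=.
by rewrite (frobD AtoL) mulrDr.
Qed.

Lemma is_expD g h y x : is_exp g y -> is_exp h x -> is_exp (g + h) (y + x).
Proof.
move=> gy hx N; have [n1 n1P] := gy N; have [n2 n2P] := hx N.
exists (maxn n1 n2) => n; rewrite geq_max => /andP[n1n n2n].
rewrite exp_partialD opprD addrACA.
by apply: (dval_ge0D vP); auto.
Qed.

Lemma is_expC c g y : is_exp g y -> is_exp (AtoL c%:P * g) (AtoL c%:P * y).
Proof.
move=> gy N; have [n0 n0P] := gy N; exists n0 => n nn0.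
have -> : exp_partial (AtoL c%:P * g) n = AtoL c%:P * exp_partial g n.
  rewrite mulr_sumr; apply: eq_bigr => i _.
  by rewrite frob_const mulrCA.
rewrite -mulrBr; apply: (dval_leMl vP); first exact: AtoL_const_ge0.
exact: n0P.
Qed.

Lemma exp_partial_t g n : exp_partial (AtoL 'X * g) n.+1 =
  AtoL 'X * exp_partial g n.+1 + exp_partial g n ^+ #|k|.
Proof.
have frob_sum m (f : nat -> L) :
    (\sum_(i < m) f i) ^+ #|k| = \sum_(i < m) f i ^+ #|k|.
  elim: m => [|m IHm].
    by rewrite !big_ord0 expr0n eqn0Ngt (ltnW (card_gt1 k)).
  rewrite !big_ord_recr /= -IHm.
  by have := frobD AtoL (\sum_(i < m) f i) (f m) 1; rewrite !expn1.
pose E : {rmorphism ratfun k -> L} := cemb L \o in_alg K.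
have partE h m :
  exp_partial h m = \sum_(i < m) E (exp_coef k i) * h ^+ (#|k| ^ i) by [].
have -> : AtoL 'X = E (ratfun_t k) by [].
rewrite !partE (frob_sum n (fun i => E (exp_coef k i) * g ^+ (#|k| ^ i))).
move: E {partE} => E.
rewrite !big_ord_recl mulrDr -addrA; congr (_ + _).
  by rewrite expn0 !expr1 mulrCA.
rewrite mulr_sumr -big_split; apply: eq_bigr => i _.
rewrite lift0 exprMn [LHS]mulrA -rmorphXn -[in LHS]rmorphM exp_coefS.
rewrite rmorphD mulrDl rmorphM -mulrA; congr (_ + _).
by rewrite rmorphXn /= expnSr exprM -exprMn.
Qed.

Lemma is_exp_t g y : is_exp g y -> is_exp (AtoL 'X * g) (carlitz_t AtoL y).
Proof.
move=> gy N.
have [T [T0 TP]] : exists T : int, 0 <= T /\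
    forall x : L, ((N + T)%:E <= v x -> N%:E <= v (AtoL 'X * x)%R)%E.
  have [t0|t0] := eqVneq (AtoL 'X) 0.
    by exists 0; split=> // x _; rewrite t0 mul0r (dval0 vP) leey.
  have [m vm] := dval_fin vP t0; exists `|m|; split=> // x Nx.
  rewrite (dvalM vP) vm; apply: (@le_trans _ _ (m%:E + (N + `|m|)%:E)%E).
    by rewrite -EFinD lee_fin addrCA lerDl -lerBlDl sub0r -normrN ler_norm.
  by rewrite leeD2l.
pose M := Num.max (N + T) (Num.max N 0).
have [n0 n0P] := gy M; exists n0.+1 => -[//|n] nn0.
rewrite exp_partial_t /carlitz_t opprD addrACA -mulrBr.
apply: (dval_ge0D vP).
  apply: TP; apply: le_trans (n0P n.+1 _); last exact: leqW.
  by rewrite lee_fin le_max lexx.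
have subX (a b : L) : a ^+ #|k| - b ^+ #|k| = (a - b) ^+ #|k|.
  have := frobD AtoL (a - b) b 1; rewrite expn1 subrK => ->.
  by rewrite addrK.
rewrite subX; have Mn := n0P n nn0.
rewrite -(ltn_predK (card_gt1 k)) exprSr; apply: (dval_leMl vP).
  apply: (dval_ge0X vP); apply: le_trans Mn.
  by rewrite lee_fin !le_max lexx !orbT.
by apply: le_trans Mn; rewrite lee_fin !le_max lexx !orbT.
Qed.

(* exp is A-linear from K_z to C_0(K_z). *)
Lemma is_expZ a g y : is_exp g y -> is_exp (AtoL a * g) (carlitz_act AtoL a y).
Proof.
elim/poly_ind: a g y => [|a c IHa] g y gy.
  by rewrite -polyC0 carlitz_actC; exact: is_expC.
rewrite rmorphD rmorphM mulrDl carlitz_actDl; apply: is_expD.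
  by rewrite carlitz_actMX [AtoL a * _]mulrC -mulrA; exact/is_exp_t/IHa.
by rewrite carlitz_actC; exact: is_expC.
Qed.

End Exponential.

Section CSheaf.
Variable Kz : forall z : place, completion z.

(* The closed points of U \ Y. *)
Definition outY (U : set curve) : Type :=
  {z : place | U (ClosedPt z) /\ ~ affineY (ClosedPt z)}.

Definition Kz_mod (z : place) : lmodType {poly k} := restr_scalars (AtoL (Kz z)).

(* C_0(K) x \prod_(z in U \ Y) K_z, containing C(U). *)
Definition C_amb (U : set curve) : lmodType {poly k} :=
  (carlitz AtoK * dprod (fun z : outY U => Kz_mod (sval z)))%type.

Definition C_set (U : set curve) (s : C_amb U) : Prop :=
  regular_sec 0 (U `&` affineY) s.1 /\
  forall z : outY U, is_exp (L := Kz (sval z)) (s.2 z) (cemb (Kz (sval z)) s.1).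

Fact C_set0 U : C_set (0 : C_amb U).
Proof.
split=> [|z]; first exact: regular_sec0.
by rewrite rmorph0; exact: is_exp0.
Qed.

Lemma regular_carlitz (U : set curve) (a : {poly k}) (c : K) :
  U `<=` affineY -> regular_sec 0 U c -> regular_sec 0 U (carlitz_act AtoK a c).
Proof.
move=> UY; elim/poly_ind: a c => [|a b IHa] c cU.
  by rewrite -polyC0 carlitz_actC; exact: regular_secZ.
rewrite carlitz_actDl carlitz_actC carlitz_actMX; apply: regular_secD.
  have {}IHa := IHa c cU; apply: regular_secD.
    have [U0|U0] := nonempty_or_set0 U; last first.
      by have [_ ->//] := IHa; rewrite mulr0; exact: regular_sec0.
    apply: regular_secM => //; split=> [z zU|UE].
      by split=> [+|/(_ (UY _ zU))//]; apply.
    by rewrite UE in U0; case: U0.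
  rewrite -(ltn_predK (card_gt1 k)); elim: #|k|.-1 => [|n IHn]; rewrite ?expr1 //.
  by rewrite exprS; exact: regular_secM.
exact: regular_secZ.
Qed.

Fact C_set_lin U a (s s' : C_amb U) : C_set s -> C_set s' -> C_set (a *: s + s').
Proof.
move=> [s1 s2] [s1' s2']; split=> [|z] /=.
  by apply: regular_secD => //; apply: regular_carlitz => //; exact: subIsetr.
rewrite rmorphD; apply: is_expD => //.
have := is_expZ a (s2 z); congr is_exp.
by apply/esym; exact: carlitz_act_morph.
Qed.

Definition C_mod U : submodule (C_amb U) := Submodule (C_set0 U) (@C_set_lin U).

Definition C_sec (U : opens curve) : lmodType {poly k} := submod_type (C_mod U).

Definition outY_incl (U V : set curve) (VU : V `<=` U) (z : outY V) : outY U :=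
  exist _ (sval z) (conj (VU _ (svalP z).1) (svalP z).2).

Definition C_amb_res (U V : set curve) (VU : V `<=` U) (s : C_amb U) : C_amb V :=
  (cut V s.1, fun z => s.2 (outY_incl VU z)).

Lemma outY_nonempty (U : set curve) : outY U -> U !=set0.
Proof. by move=> [z [zU _]]; exists (ClosedPt z). Qed.

Fact C_res_subproof (U V : opens curve) (VU : V `<=` U) (s : C_sec U) :
  C_mod V (C_amb_res VU (sm_val s)).
Proof.
have [s1 s2] := sm_valP s; split=> [|z] /=.
  have [V0|V0] := nonempty_or_set0 V; last by rewrite cut_set0 //; exact: regular_sec0.
  rewrite cut_id //; apply: regular_sec_sub s1; first exact: setSI.
  by case: V0 => x /open_generic Vg; exists Generic; split.
rewrite cut_id; last exact: outY_nonempty z.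
exact: s2 (outY_incl VU z).
Qed.

Definition C_res (U V : opens curve) (VU : V `<=` U) (s : C_sec U) : C_sec V :=
  SubmodElt (C_res_subproof VU s).

Fact C_res_linear (U V : opens curve) (VU : V `<=` U) : linear (C_res VU).
Proof.
move=> a x y; apply: sm_val_inj; congr pair.
by rewrite -cut_lin.
Qed.

HB.instance Definition _ U V VU := GRing.isLinear.Build {poly k} _ _ _
  (@C_res U V VU) (@C_res_linear U V VU).

Lemma C_sec_eq (U : opens curve) (s s' : C_sec U) :
  (sm_val s).1 = (sm_val s').1 ->
  (forall z : outY U, (sm_val s).2 z = (sm_val s').2 z) -> s = s'.
Proof.
move: s s' => [[c g] sP] [[c' g'] sP'] /= cc' gg'; apply: sm_val_inj => /=.
by congr pair => //; apply: functional_extensionality_dep.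
Qed.

Lemma C_sec_empty (U : opens curve) (s : C_sec U) :
  oset U = set0 -> (sm_val s).1 = 0.
Proof. by move=> U0; have [[_ c0] _] := sm_valP s; apply: c0; rewrite U0 set0I. Qed.

Lemma outY_irrel (U : set curve) (g : forall z : outY U, Kz_mod (sval z)) z p q :
  g (exist _ z p) = g (exist _ z q).
Proof. by rewrite (Prop_irrelevance p q). Qed.

Fact C_res_id (U : opens curve) (UU : U `<=` U) s : C_res UU s = s.
Proof.
apply: C_sec_eq => [|[z zP]] /=; last exact: outY_irrel.
have [U0|U0] := nonempty_or_set0 U; first by rewrite cut_id.
by rewrite cut_set0 // C_sec_empty.
Qed.

Fact C_res_comp (U V W : opens curve) (VU : V `<=` U) (WV : W `<=` V)
  (WU : W `<=` U) s : C_res WV (C_res VU s) = C_res WU s.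
Proof.
apply: C_sec_eq => [|[z zP]] /=; last exact: outY_irrel.
have [W0|W0] := nonempty_or_set0 W; last by rewrite !cut_set0.
by rewrite !cut_id //; case: W0 => x /WV; exists x.
Qed.

Fact C_sheaf_sep (U : opens curve) (I : Type) (V : I -> opens curve)
  (VU : forall i, V i `<=` U) : U `<=` \bigcup_i V i ->
  forall s s', (forall i, C_res (VU i) s = C_res (VU i) s') -> s = s'.
Proof.
move=> UV s s' ss'; apply: C_sec_eq => [|z].
  have [[x /UV[i _ Vx]]|U0] := nonempty_or_set0 U; last by rewrite !C_sec_empty.
  have /(congr1 (fun r : C_sec (V i) => (sm_val r).1)) := ss' i.
  by rewrite /= !cut_id //; exists x.
case: z => z zP; have [i _ Vz] := UV _ zP.1.
pose z' : outY (V i) := exist _ z (conj Vz zP.2).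
have := congr1 (fun r : C_sec (V i) => (sm_val r).2 z') (ss' i) => /= E.
transitivity ((sm_val s).2 (outY_incl (VU i) z')); first exact: outY_irrel.
by rewrite E; exact: outY_irrel.
Qed.

Fact C_sheaf_glue (U : opens curve) (I : Type) (V : I -> opens curve)
  (VU : forall i, V i `<=` U) : U `<=` \bigcup_i V i ->
  forall s : forall i, C_sec (V i),
  (forall i j (W : opens curve) (Wi : W `<=` V i) (Wj : W `<=` V j),
     C_res Wi (s i) = C_res Wj (s j)) ->
  exists s0, forall i, C_res (VU i) s0 = s i.
Proof.
move=> UV s ss; have [U0|U0] := nonempty_or_set0 U; last first.
  have VE i : oset (V i) = set0 by rewrite -subset0 -U0; exact: VU.
  exists 0 => i; rewrite linear0; apply: C_sec_eq => [|z]; first by rewrite !(C_sec_empty _ (VE i)).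
  by case: z => z [Vz zY]; exfalso; move: Vz; rewrite VE.
have [i0 [x0 Vx0]] : exists i, V i !=set0.
  by case: U0 => x /UV[i _ Vx]; exists i, x.
pose W i j := Opens (openI (osetP (V i)) (osetP (V j))).
have ssW i j := ss i j (W i j) (@subIsetl _ _ _) (@subIsetr _ _ _).
have cE i : V i !=set0 -> (sm_val (s i)).1 = (sm_val (s i0)).1.
  move=> [x Vx]; have /(congr1 (fun r : C_sec (W i i0) => (sm_val r).1)) /= := ssW i i0.
  by rewrite !cut_id //; exists Generic; split; apply: open_generic; eassumption.
have cov (z : outY U) : {i | oset (V i) (ClosedPt (sval z))}.
  by apply: cid; have [i _ Vz] := UV _ (svalP z).1; exists i.
pose lft (z : outY U) : outY (V (sval (cov z))) :=
  exist _ (sval z) (conj (svalP (cov z)) (svalP z).2).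
pose s0 : C_amb U :=
  ((sm_val (s i0)).1, fun z => (sm_val (s (sval (cov z)))).2 (lft z)).
have s0P : C_mod U s0.
  split=> [|z] /=.
    split=> [z [/UV[i _ Vz] zY]|UE].
      rewrite -(cE i); last by exists (ClosedPt z).
      by have [[+ _] _] := sm_valP (s i); apply; split.
    have : (oset U `&` affineY) Generic.
      by case: U0 => x /open_generic Ug; split.
    by rewrite UE.
  rewrite -(cE (sval (cov z))); last by exists (ClosedPt (sval z)); exact: svalP (cov z).
  by have [_ expz] := sm_valP (s (sval (cov z))); exact: (expz (lft z)).
exists (SubmodElt s0P) => i; apply: C_sec_eq => [|z] /=.
  have [V0|V0] := nonempty_or_set0 (V i); first by rewrite cut_id //; exact/esym/cE.
  by rewrite cut_set0 // C_sec_empty.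
case: z => z zP; set z1 := outY_incl (VU i) _; set j := sval (cov z1).
pose zW : outY (W j i) := exist _ z (conj (conj (svalP (cov z1)) zP.1) zP.2).
have /= E := congr1 (fun r : C_sec (W j i) => (sm_val r).2 zW) (ssW j i).
transitivity ((sm_val (s j)).2 (outY_incl (@subIsetl _ (V j) (V i)) zW)).
  exact: outY_irrel.
by rewrite E; exact: outY_irrel.
Qed.

Definition sheafC : sheaf {poly k} curve := @Sheaf {poly k} curve C_sec
  (fun U V VU => C_res VU) (@C_res_id) (@C_res_comp) (@C_sheaf_sep) (@C_sheaf_glue).

End CSheaf.
End Curve.

(* Main.v *)
From HB Require Import structures.
Require Import Defs.
From mathcomp Require Import all_boot all_order all_algebra all_field.
From mathcomp Require Import all_classical all_reals.
From mathcomp Require Import topology.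
From mathcomp Require Import finmap zify ring.

(** Write phi for the action of t on the Carlitz module, c |-> t c + c^q, and T for the
    variable of K (x) A = K[T].  Then ∂ sends a polynomial p to T p - phi(p), phi being
    applied to the coefficients.

    On Y the theorem is the remark that K[T] / (T - phi) is K with T acting as phi: a
    section p = sum_i p_i T^i goes to sum_i phi^i(p_i) in C_0, every c is the image of
    the constant polynomial c, and Horner's scheme divides p by T - phi.

    At a place z above infinity, let v(t) = -e < 0.  The coefficient of x^(q^i) in the
    Carlitz exponential has valuation e i q^i, and this makes exp a bijective isometry
    of the ball {v >= -e} of K_z: each term of index i >= 1 is strictly smaller than x
    there (exp_term_ge, exp_surj).  This ball is the completed stalk of O_X(oo), so
    every section f of O_X(oo) has a logarithm log_z f in it (carlitz_log), and the
    second map is the A-linear extension of f |-> (f, (log_z f)_z) (log_sec,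
    carlitz_ev).  It kills the image of ∂ because log_z (phi f) = t log_z f when f is
    integral.

    Exactness in the middle (pi_kernel).  If p is a section of O_X(oo) (x) A of image 0,
    Horner's scheme gives r with ∂ r = p, regular on Y.  The same scheme
    applied to the log_z p_i yields elements rho_i of K_z with rho_0 = 0,
    t rho_(i+1) = rho_i - log_z p_i and exp rho_(i+1) = r_i; by induction all of them are
    integral, so r is integral at z.

    Surjectivity.  Near a point of Y, shrink to an open set contained in Y.  Near z above
    infinity (pi_surj_infinite), let (c, gamma) be a germ of C.  As t^-1 is topologically
    nilpotent and K is dense in K_z, there are N and f in K, integral at z, such that
    gamma - t^N log_z f is integral (exists_log_approx); then f T^N + (c - phi^N(f)) is a
    preimage on the neighbourhood of z obtained by removing the other places above
    infinity and the poles of f.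

    That this is a neighbourhood is the finiteness of the set of poles of an element
    of K (finite_poles).  It is deduced from the degree bound on the number of places
    above a place of the projective line (places_over_bound), which follows from weak
    approximation (approximation). *)

Set Implicit Arguments.
Unset Strict Implicit.
Unset Printing Implicit Defensive.

Import Order.TTheory GRing.Theory Num.Theory.

Local Open Scope classical_set_scope.
Local Open Scope ring_scope.

(** * Discrete valuations *)

Lemma lte_intE (a : int) (x : \bar int) : (a%:E < x)%E = ((a + 1)%:E <= x)%E.
Proof.
by case: x => [b| |]; rewrite ?ltry ?leey // lte_fin lee_fin lezD1.
Qed.

Section Powers.
Variables (L : fieldType) (v : L -> \bar int) (vP : is_dval v).
Implicit Types (x : L) (a : int) (n : nat).

Lemma dval_neq0 x a : v x = a%:E -> x != 0.
Proof. by move=> vx; apply/eqP => x0; move: vx; rewrite x0 (dval0 vP). Qed.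

Lemma dvalX x a n : v x = a%:E -> v (x ^+ n) = (a *+ n)%:E.
Proof.
move=> vx; elim: n => [|n IHn]; first by rewrite expr0 mulr0n (dval1E vP).
by rewrite exprS (dvalM vP) IHn vx mulrS EFinD.
Qed.

Lemma dval_inv x a : v x = a%:E -> v x^-1 = (- a)%:E.
Proof.
move=> vx; have x0 := dval_neq0 vx.
have [b vb] := dval_fin vP (invr_neq0 x0).
have := dvalM vP x x^-1; rewrite divff // (dval1E vP) vx vb -EFinD => -[] ab.
by congr (_%:E); lia.
Qed.

Lemma dvalXz x a (m : int) : v x = a%:E -> v (x ^ m) = (a * m)%:E.
Proof.
case: m => n vx; first by rewrite -exprnP (dvalX n vx) pmulrn -mulrzr intz.
by rewrite -[x ^ _]/(x ^- n.+1) (dval_inv (dvalX n.+1 vx)) NegzE mulrN pmulrn -mulrzr intz.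
Qed.

End Powers.

Section DiscreteValuation.
Variables (L : fieldType) (v : L -> \bar int) (vP : is_dval v).
Implicit Types (x y : L) (a b N : int) (n : nat).

Lemma dval_div x y a b : v x = a%:E -> v y = b%:E -> v (x / y) = (a - b)%:E.
Proof. by move=> vx vy; rewrite (dvalM vP) vx (dval_inv vP vy). Qed.

Lemma dvalN x : v (- x) = v x.
Proof.
have N10 : (- 1 : L) != 0 by rewrite oppr_eq0 oner_eq0.
have [a va] := dval_fin vP N10.
have := dvalM vP (- 1) (- 1); rewrite mulrNN mulr1 (dval1E vP) va -EFinD.
case=> aa; have a0 : a = 0 by lia.
by rewrite -mulN1r (dvalM vP) va a0 add0e.
Qed.

Lemma dval_geB x y (N : \bar int) : (N <= v x)%E -> (N <= v y)%E -> (N <= v (x - y)%R)%E.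
Proof. by move=> Nx Ny; apply: (dval_ge0D vP); rewrite ?dvalN. Qed.

Lemma dval_ge_sum (I : Type) (r : seq I) (P : pred I) (F : I -> L) (N : \bar int) :
  (forall i, P i -> (N <= v (F i))%E) -> (N <= v (\sum_(i <- r | P i) F i)%R)%E.
Proof.
move=> NF; apply: (big_ind (fun x => N <= v x)%E) => //.
  by rewrite (dval0 vP) leey.
by move=> x y; exact: (dval_ge0D vP).
Qed.

Lemma dvalD_lt x y : (v x < v y)%E -> v (x + y) = v x.
Proof.
move=> xy; apply/eqP; rewrite eq_le; apply/andP; split; last first.
  by apply: (dval_ge0D vP) => //; exact: ltW.
rewrite leNgt; apply/negP => xxy.
have [a va] : exists a, v x = a%:E.
  by apply: (dval_fin vP); apply: contraTneq xy => ->; rewrite (dval0 vP) ltNge leey.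
move: xy xxy; rewrite va !lte_intE => xy xxy.
have := dval_geB xxy xy; rewrite addrK va -lte_intE.
by rewrite ltxx.
Qed.

Lemma vcvg_ge (u : nat -> L) (l : L) N :
  vcvg v u l -> (forall n, (N%:E <= v (u n))%E) -> (N%:E <= v l)%E.
Proof.
move=> ul uN; have [n0 /(_ n0 (leqnn _)) ulN] := ul N.
by have := dval_geB (uN n0) ulN; rewrite subKr.
Qed.

Lemma dval_inf x : (forall N, (N%:E <= v x)%E) -> x = 0.
Proof.
move=> xN; apply/eqP/negPn/negP => /(dval_fin vP)[a va].
by have := xN (a + 1); rewrite va lee_fin; lia.
Qed.

Lemma vcvg_unique (u : nat -> L) (l l' : L) : vcvg v u l -> vcvg v u l' -> l = l'.
Proof.
move=> ul ul'; apply/eqP; rewrite -subr_eq0; apply/eqP/dval_inf => N.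
have [n1 n1P] := ul N; have [n2 n2P] := ul' N.
have := dval_geB (n2P _ (leq_maxr n1 n2)) (n1P _ (leq_maxl n1 n2)).
by rewrite addrC opprB subrKA.
Qed.

(** If u is a uniformizer of v and c = w u >= 0, then w = c v, since the units of v
    are units of w; and c = 1 because w is normalized. *)
Lemma dval_ring_inj (w : L -> \bar int) : is_dval w ->
  (forall x, (0 <= v x)%E -> (0 <= w x)%E) -> v = w.
Proof.
move=> wP vw; have [u vu] := dval_unif vP.
have u0 := dval_neq0 vP vu; have [c wu] := dval_fin wP u0.
have c0 : 0 <= c by rewrite -lee_fin -wu vw // vu.
have w_unit y : v y = 0%:E -> w y = 0%:E.
  move=> vy; have [d wy] := dval_fin wP (dval_neq0 vP vy).
  have d0 : 0 <= d by rewrite -lee_fin -wy vw // vy.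
  have := vw y^-1; rewrite (dval_inv vP vy) (dval_inv wP wy) oppr0 lexx lee_fin => /(_ isT) dN0.
  by rewrite wy; congr _%:E; lia.
have wE x a : v x = a%:E -> w x = (a * c)%:E.
  move=> vx; have vua := dvalXz vP a vu.
  have /w_unit wy : v (x / u ^ a) = 0%:E by rewrite (dval_div vx vua) mul1r subrr.
  rewrite -(divfK (dval_neq0 vP vua) x) (dvalM wP) wy (dvalXz wP a wu).
  by rewrite add0e mulrC.
have c1 : c = 1.
  have [x wx] := dval_unif wP.
  have x0 : x != 0 by apply/eqP => x0; move: wx; rewrite x0 (dval0 wP).
  have [a vx] := dval_fin vP x0.
  have := wE _ _ vx; rewrite wx => -[] ac1.
  have : (c %| 1)%Z by apply/dvdzP; exists a.
  by rewrite dvdz1; lia.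
apply/funext => x; have [->|x0] := eqVneq x 0; first by rewrite (dval0 vP) (dval0 wP).
have [a vx] := dval_fin vP x0.
by rewrite (wE _ _ vx) vx c1 mulr1.
Qed.

End DiscreteValuation.

(** * Finiteness of the set of poles *)

Lemma fraction_numden (R : idomainType) (x : {fraction R}) :
  exists n d : R, d != 0 /\ x * FracField.tofrac d = FracField.tofrac n.
Proof.
elim/generic_quotient.quotW: x => x; exists (x : {ratio R}).1, (x : {ratio R}).2.
split; first exact: denom_ratioP.
rewrite -[LHS]/(FracField.mul _ _) !generic_quotient.piE; apply/eqP.
rewrite generic_quotient.piE /FracField.equivf /FracField.mulf /=.
by rewrite !numden_Ratio ?mulf_neq0 ?denom_ratioP ?oner_eq0 // !mulr1 mulrC.
Qed.

Section Places.
Variables (k : finFieldType) (K : fieldExtType (ratfun k)).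
Implicit Types (v w : place K) (a b p : {poly k}).
Local Notation AtoK := (@AtoK k K).
Local Notation affine v := (forall a, (0 <= ord v (AtoK a))%E).

HB.instance Definition _ := gen_eqMixin (place K).
HB.instance Definition _ := gen_choiceMixin (place K).

Lemma place_inj v w : (forall x, (0 <= v x)%E -> (0 <= w x)%E) -> v = w.
Proof.
case: v w => v vP vk [w wP wk] /= vw; have vwE := dval_ring_inj vP wP vw.
by subst w; congr Place; exact: Prop_irrelevance.
Qed.

Lemma AtoK_eq0 a : (AtoK a == 0) = (a == 0).
Proof. by rewrite /Defs.AtoK fmorph_eq0 tofrac_eq0. Qed.

Lemma ord_const0 v (c : k) : c != 0 -> v (AtoK c%:P) = 0%E.
Proof.
move=> c0; have vP := ord_dval v.
have cK0 : AtoK c%:P != 0 by rewrite AtoK_eq0 polyC_eq0.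
have [a va] := dval_fin vP cK0; have := ord_const v c^-1.
have -> : AtoK (c^-1)%:P = (AtoK c%:P)^-1.
  by apply: (mulfI cK0); rewrite divff // -rmorphM -polyCM divff // polyC1 rmorph1.
rewrite (dval_inv vP va) va; have := ord_const v c; rewrite va !lee_fin => ? ?.
by congr _%:E; lia.
Qed.

Lemma affineE v : (0 <= v (tK K))%E -> affine v.
Proof.
have vP := ord_dval v; move=> t0; elim/poly_ind => [|a c IHa].
  by rewrite rmorph0 (dval0 vP) leey.
rewrite rmorphD rmorphM; apply: (dval_ge0D vP); last exact: ord_const.
exact: (dval_ge0M vP).
Qed.

Lemma not_affineP v : ~ affineY (ClosedPt v) <->
  exists2 e : int, 0 < e & v (tK K) = (- e)%:E.
Proof.
have vP := ord_dval v; split=> [nY|[e e0 vt] /(_ 'X)]; last first.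
  by rewrite vt lee_fin; lia.
have : (v (tK K) < 0)%E by rewrite ltNge; apply/negP => /affineE.
case vt: (v (tK K)) => [e| |] //; last first.
  by have := dval_fin vP (x := tK K); rewrite vt AtoK_eq0 polyX_eq0 => /(_ isT)[].
by rewrite lte_fin => e0; exists (- e); rewrite ?opprK //; lia.
Qed.

(** The quotient of an element integral at w only by one integral at v only. *)
Lemma separate_places v w : v != w -> exists x, (v x < 0)%E /\ (0 < w x)%E.
Proof.
move=> vw; have [vP wP] := (ord_dval v, ord_dval w).
have ring_sep (u u' : place K) : u != u' -> exists x, (0 <= u x)%E /\ (u' x < 0)%E.
  move=> uu'; apply: contrapT => H; move/eqP: uu'; apply; apply: place_inj => x ux.
  by rewrite leNgt; apply/negP => u'x; apply: H; exists x.
have [a [va wa]] := ring_sep v w vw.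
have [b [wb vb]] : exists x, (0 <= w x)%E /\ (v x < 0)%E.
  by apply: ring_sep; rewrite eq_sym.
have neg_neq0 (u : place K) x : (u x < 0)%E -> x != 0.
  by apply: contraTneq => ->; rewrite (dval0 (ord_dval u)) ltNge leey.
have [a0 b0] := (neg_neq0 _ _ wa, neg_neq0 _ _ vb).
have [va' vaE] := dval_fin vP a0; have [wa' waE] := dval_fin wP a0.
have [vb' vbE] := dval_fin vP b0; have [wb' wbE] := dval_fin wP b0.
exists (b / a); rewrite (dval_div vP vbE vaE) (dval_div wP wbE waE).
move: va wa wb vb; rewrite vaE waE wbE vbE !lee_fin !lte_fin; lia.
Qed.

(** A weak form of weak approximation, proved by adding one place v at a time.  Let x
    be suitable for the previous places, and let y have a pole at w and a zero at v.
    If x has no pole at v, then x^r y is suitable for large r.  Otherwise x^r is replaced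
    by x^r / (1 + x^r), a unit at w and at v which still vanishes to high order
    at the previous places. *)
Lemma approximation w (s : seq (place K)) : w \notin s ->
  exists x, (w x < 0)%E /\ forall v, v \in s -> (0 < v x)%E.
Proof.
have wP := ord_dval w.
elim: s => [_|v s IHs].
  have [u wu] := dval_unif wP; exists u^-1; split=> //.
  by rewrite (dval_inv wP wu).
rewrite inE negb_or => /andP[wv /IHs[x [wx sx]]].
have vP := ord_dval v.
have [y [wy vy]] := separate_places wv.
have neg_neq0 z : (w z < 0)%E -> z != 0.
  by apply: contraTneq => ->; rewrite (dval0 wP) ltNge leey.
have [x0 y0] := (neg_neq0 _ wx, neg_neq0 _ wy).
have [r rP] : exists r : nat, forall u, u \in s -> ((- r%:Z)%:E < u y)%E.
  elim: s {IHs sx} => [|u s [r rP]]; first by exists 0%N.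
  have [b uy] := dval_fin (ord_dval u) y0.
  exists (maxn r `|b|.+1)%N => u'; rewrite inE => /predU1P[->|/rP].
    by rewrite uy lte_fin; lia.
  by apply: le_lt_trans; rewrite lee_fin; lia.
have xry u : u \in s -> (0 < u (x ^+ r.+1)%R)%E /\ (0 < u (x ^+ r.+1 * y)%R)%E.
  move=> us; have uP := ord_dval u; move: (sx u us) (rP u us).
  have [a ux] := dval_fin uP x0; have [b uy] := dval_fin uP y0.
  rewrite (dvalM uP) (dvalX uP r.+1 ux) ux uy -EFinD !lte_fin pmulrn -mulrzr intz.
  by move=> ? ?; split; nia.
have [a vxE] := dval_fin vP x0; have [b wxE] := dval_fin wP x0.
have [c vyE] := dval_fin vP y0; have [d wyE] := dval_fin wP y0.
have vxr := dvalX vP r.+1 vxE; have wxr := dvalX wP r.+1 wxE.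
move: wx wy vy; rewrite wxE wyE vyE !lte_fin => b0 d0 c0.
have [a0|a0] := leP 0 a.
  exists (x ^+ r.+1 * y); rewrite (dvalM wP) wxr wyE -EFinD lte_fin.
  split=> [|u]; first by rewrite pmulrn -mulrzr intz; nia.
  rewrite inE => /predU1P[->|/xry[]//].
  by rewrite (dvalM vP) vxr vyE -EFinD lte_fin pmulrn -mulrzr intz; nia.
have unit (u : place K) e : e < 0 -> u x = e%:E -> u (x ^+ r.+1 / (1 + x ^+ r.+1)) = 0%:E.
  move=> e0 ux; have uP := ord_dval u; have uxr := dvalX uP r.+1 ux.
  have u1 : u (1 + x ^+ r.+1) = (e *+ r.+1)%:E.
    rewrite addrC (dvalD_lt uP) // uxr (dval1E uP) lte_fin pmulrn -mulrzr intz.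
    by nia.
  by rewrite (dval_div uP uxr u1) subrr.
exists (x ^+ r.+1 / (1 + x ^+ r.+1) * y).
rewrite (dvalM wP) (unit _ b) // wyE add0e lte_fin; split=> // u.
rewrite inE => /predU1P[->|us].
  by rewrite (dvalM vP) (unit _ a) // vyE add0e lte_fin.
have uP := ord_dval u; have [xr0 xry0] := xry u us.
have u1 : u (1 + x ^+ r.+1) = 0%:E by rewrite (dvalD_lt uP) (dval1E uP).
by rewrite mulrAC (dvalM uP) (dval_inv uP u1) oppr0 adde0.
Qed.

End Places.

Section FinitePoles.
Variables (k : finFieldType) (K : fieldExtType (ratfun k)).
Implicit Types (v w : place K) (a b p : {poly k}).
Local Notation AtoK := (@AtoK k K).
Local Notation affine v := (forall a, (0 <= ord v (AtoK a))%E).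

Lemma poly_relation (m : nat) (x : 'I_m -> K) : (\dim {:K} < m)%N ->
  exists a : 'I_m -> {poly k}, (exists i, a i != 0) /\
    \sum_i AtoK (a i) * x i = 0.
Proof.
move=> dim_lt; pose X := [tuple x i | i < m].
have nfree : ~~ free X.
  apply: contraTN dim_lt; rewrite -leqNgt => /eqP free_dim.
  by rewrite -[m](size_tuple X) -free_dim dimvS // subvf.
have [c cX [i ci]] : exists2 c : 'I_m -> ratfun k, \sum_i c i *: X`_i = 0 & exists i, c i != 0.
  apply: contrapT => H; move/negP: nfree; apply; apply/freeP => c cX i.
  by apply/eqP/negPn/negP => ci; apply: H; exists c => //; exists i.
pose nd j := cid (fraction_numden (c j)).
pose n j := sval (nd j); pose d j := sval (cid (svalP (nd j))).
have [d0 cd] : (forall j, d j != 0) /\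
    forall j, c j * FracField.tofrac (d j) = FracField.tofrac (n j).
  by split=> j; have [] := svalP (cid (svalP (nd j))).
exists (fun j => n j * \prod_(l | l != j) d l); split.
  exists i; rewrite mulf_neq0 //; last by apply/prodf_neq0 => j _; exact: d0.
  by rewrite -tofrac_eq0 -cd mulf_neq0 ?tofrac_eq0.
(* The denominators d_j are cleared by multiplying the relation by their product. *)
pose D := \prod_l d l.
transitivity (AtoK D * \sum_j c j *: X`_j); last by rewrite cX mulr0.
rewrite mulr_sumr; apply: eq_bigr => j _.
rewrite -(tnth_nth 0) tnth_mktuple /Defs.AtoK /= !mulr_algl scalerA; congr (_ *: _).
have -> : D = d j * \prod_(l | l != j) d l by exact: bigD1.
by rewrite !tofracM mulrAC [_ * c j]mulrC cd.
Qed.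

(** The second hypothesis says that all the places lie over the same place of the projective
    line.  By approximation, choose x_i with a pole at the i-th place and zeros
    at the others.  A relation sum_j a_j x_j = 0 with a_j in k[t] is impossible: if
    a_i has the least valuation among the a_j, then a_i x_i has strictly smaller
    valuation at the i-th place than any other term. *)
Lemma places_over_bound (m : nat) (z : 'I_m -> place K) : injective z ->
  (forall i j a b, (z i (AtoK a) <= z i (AtoK b))%E -> (z j (AtoK a) <= z j (AtoK b))%E) ->
  (m <= \dim {:K})%N.
Proof.
move=> z_inj zz; rewrite leqNgt; apply/negP => dim_lt.
have apx i : {x | (z i x < 0)%E /\ forall j, j != i -> (0 < z j x)%E}.
  apply: cid; have [|x [zx sx]] := @approximation _ _ (z i) [seq z j | j <- enum 'I_m & j != i].
    apply/negP => /mapP[j]; rewrite mem_filter => /andP[ji _] /z_inj ij.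
    by rewrite ij eqxx in ji.
  exists x; split=> // j ji; apply: sx; apply: map_f.
  by rewrite mem_filter ji mem_enum.
pose x i := sval (apx i).
have [a [[i0 ai0] ax]] := poly_relation x dim_lt.
pose i := [arg min_(i < i0) z i0 (AtoK (a i))]%O.
have amin j : (z i (AtoK (a i)) <= z i (AtoK (a j)))%E.
  apply: (zz i0); rewrite /i; case: arg_minP => // l _; exact.
have zP := ord_dval (z i).
have [al zai] : exists al, z i (AtoK (a i)) = al%:E.
  apply: (dval_fin zP); rewrite AtoK_eq0; apply: contraNneq ai0 => ai.
  have := amin i0; rewrite ai rmorph0 (dval0 zP) leye_eq => /eqP /(dval_eq0 zP)/eqP.
  by rewrite AtoK_eq0.
have [xi zxi] : exists xi, z i (x i) = xi%:E.
  apply: (dval_fin zP); apply: contraTneq (svalP (apx i)).1 => xi0.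
  by rewrite -/(x i) xi0 (dval0 zP) ltNge leey.
have xi_neg : xi < 0 by have := (svalP (apx i)).1; rewrite -/(x i) zxi lte_fin.
have := ax; rewrite (bigD1 i) //= => /eqP; rewrite addr_eq0 => /eqP /(congr1 (z i)).
rewrite (dvalN zP) (dvalM zP) zai zxi -EFinD => zE.
suff : ((al + xi + 1)%:E <= z i (\sum_(j | j != i) AtoK (a j) * x j)%R)%E.
  by rewrite -zE lee_fin; lia.
apply: (dval_ge_sum zP) => j ji; rewrite (dvalM zP).
apply: (@le_trans _ _ (al%:E + (xi + 1)%:E)%E); first by rewrite -EFinD addrA.
apply: leeD.
  by rewrite -zai.
apply: (@le_trans _ _ 0%:E); first by rewrite lee_fin; lia.
by apply: ltW; case: (svalP (apx j)) => _; apply; rewrite eq_sym.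
Qed.

Lemma finite_places_over (P : set (place K)) :
  (forall v w, P v -> P w -> forall a b,
     (v (AtoK a) <= v (AtoK b))%E -> (w (AtoK a) <= w (AtoK b))%E) ->
  finite_set P.
Proof.
move=> PP; apply: contrapT => /(infinite_set_fset (\dim {:K}).+1)[B BP leB].
have /tuple_uniqP B_inj : uniq (in_tuple (enum_fset B)) := fset_uniq B.
have : (#|` B|%fset <= \dim {:K})%N.
  apply: (@places_over_bound _ (tnth (in_tuple (enum_fset B)))) => [|i j a b] //.
  by apply: PP; apply: BP; exact: mem_tnth.
by rewrite leqNgt leB.
Qed.

(** By Bezout: were a to vanish at v as well, so would 1. *)
Lemma irreducible_ord p v a : irreducible_poly p -> affine v -> (0 < v (AtoK p))%E ->
  ~~ (p %| a) -> v (AtoK a) = 0%E.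
Proof.
move=> p_irr vA vp pa; have vP := ord_dval v.
have /Bezout_eq1_coprimepP[[s t] /= st] : coprimep p a by rewrite irreducible_poly_coprime.
apply/eqP; rewrite eq_le vA andbT leNgt; apply/negP => va.
suff : ((0 + 1)%:E <= v (AtoK 1))%E by rewrite rmorph1 (dval1E vP).
have ge1 c b : (0 < v (AtoK b))%E -> ((0 + 1)%:E <= v (AtoK (c * b)))%E.
  rewrite rmorphM (dvalM vP) lte_intE => vb.
  rewrite -[leLHS]add0e; apply: leeD; [exact: vA|exact: vb].
by rewrite -st rmorphD; apply: (dval_ge0D vP); apply: ge1.
Qed.

Lemma irreducible_decomp p a : irreducible_poly p -> a != 0 ->
  exists e b, a = p ^+ e * b /\ ~~ (p %| b).
Proof.
move=> [p1 _]; have [n] := ubnP (size a); elim: n a => // n IHn a an a0.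
have [/dvdpP[b ab]|pa] := boolP (p %| a); last by exists 0%N, a; rewrite mul1r.
have b0 : b != 0 by apply: contraNneq a0 => b0; rewrite ab b0 mul0r.
have p0 : p != 0 by rewrite -size_poly_gt0 ltnW.
have [|e [c [bE pc]]] := IHn b _ b0.
  have lt_size (x y m : nat) : ((x + y).-1 < m.+1 -> 1 < y -> x < m)%N by lia.
  by apply: lt_size p1; rewrite -size_mul // -ab.
by exists e.+1, c; rewrite ab bE exprSr mulrAC.
Qed.

(** On k[t], a place where p vanishes is a multiple of the p-adic valuation, so all such
    places lie over the same place of the projective line. *)
Lemma finite_zeros_irreducible p : irreducible_poly p ->
  finite_set [set v : place K | affine v /\ (0 < v (AtoK p))%E].
Proof.
move=> p_irr; apply: finite_places_over => v w [vA vp] [wA wp] a b.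
have [->|a0] := eqVneq a 0.
  rewrite !rmorph0 (dval0 (ord_dval v)) leye_eq => /eqP /(dval_eq0 (ord_dval v)) /eqP.
  by rewrite AtoK_eq0 => /eqP ->; rewrite rmorph0.
have [->|b0] := eqVneq b 0; first by rewrite rmorph0 (dval0 (ord_dval w)) leey.
have [e [a' [aE pa']]] := irreducible_decomp p_irr a0.
have [f [b' [bE pb']]] := irreducible_decomp p_irr b0.
have ordE (u : place K) : affine u -> (0 < u (AtoK p))%E ->
    exists2 d : int, 0 < d & forall n c, ~~ (p %| c) -> u (AtoK (p ^+ n * c)) = (n%:Z * d)%:E.
  move=> uA up; have uP := ord_dval u.
  have [d ud] : exists d, u (AtoK p) = d%:E.
    apply: (dval_fin uP); rewrite AtoK_eq0; have [p1 _] := p_irr.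
    by rewrite -size_poly_gt0 ltnW.
  exists d; first by rewrite -lte_fin -ud.
  move=> n c pc; rewrite rmorphM (dvalM uP) (irreducible_ord p_irr uA up pc) rmorphXn.
  by rewrite (dvalX uP n ud) adde0 pmulrn -mulrzl intz.
have [d d0 vE] := ordE v vA vp; have [d' d'0 wE] := ordE w wA wp.
by rewrite aE bE !vE // !wE // !lee_fin; rewrite !ler_pM2r.
Qed.

Lemma finite_zeros b : b != 0 ->
  finite_set [set v : place K | affine v /\ (0 < v (AtoK b))%E].
Proof.
have [n] := ubnP (size b); elim: n b => // n IHn b bn b0.
have [/size_poly1P[c c0 ->]|b1] := boolP (size b == 1%N).
  apply: sub_finite_set (finite_set0 _) => v [_].
  by rewrite ord_const0 // ltxx.
have bgt1 : (1 < size b)%N by rewrite ltn_neqAle eq_sym b1 size_poly_gt0.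
have [b_irr|b_red] := pselect (irreducible_poly b); first exact: finite_zeros_irreducible.
have [q [q1 qb qNb]] : exists q : {poly k}, [/\ size q != 1%N, q %| b & ~ q %= b].
  apply: contrapT => H; apply: b_red; split=> // q q1 qb.
  by apply/negPn/negP => /negP qNb; apply: H; exists q.
have [r bE] := dvdpP _ _ qb.
have [r0 q0] : r != 0 /\ q != 0.
  by apply/andP; move: b0; rewrite bE mulf_eq0 negb_or.
have size_b : size b = (size r + size q).-1 by rewrite bE size_mul.
have q_lt : (size q < size b)%N.
  rewrite ltn_neqAle dvdp_leq // andbT; apply/negP => /eqP size_qb; apply: qNb.
  by rewrite -dvdp_size_eqp // size_qb.
have qn : (size q < n)%N by apply: leq_trans q_lt _.
have rn : (size r < n)%N.
  apply: leq_trans (_ : size b <= n)%N => //; rewrite size_b.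
  by move: q0 q1; rewrite -size_poly_gt0; lia.
have Fr := IHn r rn r0; have Fq := IHn q qn q0.
apply: sub_finite_set (_ : finite_set ([set v : place K | affine v /\ (0 < v (AtoK r))%E]
  `|` [set v : place K | affine v /\ (0 < v (AtoK q))%E])); last by rewrite finite_setU.
move=> v [vA]; rewrite bE rmorphM (dvalM (ord_dval v)) => vrq.
have [vr|vr] := leP (v (AtoK r)) 0%E; last by left.
right; split=> //; apply: lt_le_trans vrq _.
by rewrite -[leRHS]add0e leeD.
Qed.

Lemma ord_infinite v e a : 0 < e -> v (tK K) = (- e)%:E -> a != 0 ->
  v (AtoK a) = (- e *+ (size a).-1)%:E.
Proof.
move=> e0 vt; have vP := ord_dval v; elim/poly_ind: a => [|a c IHa]; first by rewrite eqxx.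
have [->|a0] := eqVneq a 0.
  rewrite mul0r add0r polyC_eq0 => c0.
  by rewrite ord_const0 // size_polyC c0 mulr0n.
move=> _; rewrite rmorphD rmorphM.
have vaX : v (AtoK a * AtoK 'X) = (- e *+ size a)%:E.
  rewrite (dvalM vP) IHa // vt -EFinD -mulrSr prednK // size_poly_gt0 //.
have size_aX : size (a * 'X + c%:P) = (size a).+1.
  by rewrite size_MXaddC (negPf a0).
rewrite size_aX /= -vaX; apply: (dvalD_lt vP).
apply: lt_le_trans (ord_const v c); rewrite vaX lte_fin mulNrn oppr_lt0.
by rewrite pmulrn_lgt0 // size_poly_gt0.
Qed.

(** On k[t], these places are multiples of minus the degree. *)
Lemma finite_infinite : finite_set [set v : place K | ~ affineY (ClosedPt v)].
Proof.
apply: finite_places_over => v w /not_affineP[e e0 vt] /not_affineP[f f0 wt] a b.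
have [->|a0] := eqVneq a 0.
  rewrite !rmorph0 (dval0 (ord_dval v)) leye_eq => /eqP /(dval_eq0 (ord_dval v)) /eqP.
  by rewrite AtoK_eq0 => /eqP ->; rewrite rmorph0.
have [->|b0] := eqVneq b 0; first by rewrite rmorph0 (dval0 (ord_dval w)) leey.
rewrite (ord_infinite e0 vt) // (ord_infinite e0 vt) //.
rewrite (ord_infinite f0 wt) // (ord_infinite f0 wt) //.
by rewrite !lee_fin !mulNrn !lerN2 !ler_pMn2l.
Qed.

(** Clearing denominators in an algebraic equation of f over k(t), let a_d be the leading
    coefficient; at a place above k[t] where a_d does not vanish, f is
    integral. *)
Lemma finite_poles (f : K) : finite_set [set v : place K | (v f < 0)%E].
Proof.
have [a [[i0 ai0] af]] := poly_relation (fun i : 'I_(\dim {:K}).+1 => f ^+ i) (ltnSn _).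
have [d ad dmax] := @arg_maxnP _ i0 (fun i => a i != 0) (fun i => val i) ai0.
apply: sub_finite_set (_ : finite_set ([set v : place K | ~ affineY (ClosedPt v)]
  `|` [set v : place K | affine v /\ (0 < v (AtoK (a d)))%E])); last first.
  by rewrite finite_setU; split; [exact: finite_infinite|exact: finite_zeros].
move=> v vf; have vP := ord_dval v.
have [vA|] := pselect (affineY (ClosedPt v)); last by left.
right; split=> //; rewrite lt_neqAle vA andbT; apply/negP => /eqP vad.
have [n vfn] : exists n, v f = n%:E.
  by apply: (dval_fin vP); apply: contraTneq vf => -> /=; rewrite (dval0 vP) ltNge leey.
have n0 : n < 0 by move: vf; rewrite /= vfn lte_fin.
have := af; rewrite (bigD1 d) //= => /eqP; rewrite addr_eq0 => /eqP /(congr1 v).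
rewrite (dvalN vP) (dvalM vP) -vad add0e (dvalX vP d vfn) => vE.
suff : ((n *+ d + 1)%:E <= v (\sum_(i | i != d) AtoK (a i) * f ^+ i)%R)%E.
  by rewrite -vE lee_fin; lia.
apply: (dval_ge_sum vP) => i id.
have [->|ai] := eqVneq (a i) 0; first by rewrite rmorph0 mul0r (dval0 vP) leey.
have lt_id : (i < d)%N by rewrite ltn_neqAle id; exact: dmax.
rewrite (dvalM vP) (dvalX vP i vfn) -[leLHS]add0e; apply: leeD; first exact: vA.
by rewrite lee_fin lezD1 ltr_nMn2l.
Qed.

End FinitePoles.

(** * The Carlitz exponential at a place above infinity *)

(** At a place above infinity, exp is bijective on the ball of elements whose pole
    is at most that of t; this is its inverse there, with a default value 0 elsewhere. *)
Definition carlitz_log (k : finFieldType) (K : fieldExtType (ratfun k)) (z : place K)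
    (L : completion z) (y : L) : L :=
  xget 0 [set g | (cval (AtoL L 'X) <= cval g)%E /\ is_exp g y].

Section ExpInfinity.
Variables (k : finFieldType) (K : fieldExtType (ratfun k)) (z : place K).
Variables (L : completion z) (e : int).
Variables (e_gt0 : 0 < e) (zt : z (tK K) = (- e)%:E).
Local Notation v := (@cval K z L).
Let vP : is_dval v := cval_dval L.
Implicit Types (g h y : L) (N : int).

Lemma ord_exp_coef i : z (in_alg K (exp_coef k i)) = (e *+ (i * #|k| ^ i))%:E.
Proof.
have zP := ord_dval z.
elim: i => [|i IHi]; first by rewrite (_ : exp_coef k 0 = 1) // rmorph1 (dval1E zP).
have -> : exp_coef k i.+1 =
    exp_coef k i ^+ #|k| / (ratfun_t k ^+ (#|k| ^ i.+1) - ratfun_t k) by [].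
have tX : z (tK K ^+ (#|k| ^ i.+1) - tK K) = (- e *+ (#|k| ^ i.+1))%:E.
  rewrite (dvalD_lt zP) (dvalX zP _ zt) // (dvalN zP) zt lte_fin mulNrn ltrN2.
  rewrite -[X in X < _](mulr1n e) (ltr_pMn2l e_gt0).
  by rewrite -[X in (X < _)%N](expn0 #|k|) ltn_exp2l // card_gt1.
rewrite fmorph_div rmorphB !rmorphXn (dval_div zP (dvalX zP _ IHi) tX).
by rewrite mulNrn opprK -mulrnA -mulnA -expnSr -mulrnDr addnC -mulSn.
Qed.

(** The term has valuation q^i (e i + v(g)), and for i > 0 the second factor is
    nonnegative, so that q^i can be replaced by 1. *)
Lemma exp_term_ge g N i : - e <= N -> (N%:E <= v g)%E ->
  ((N + i%:Z)%:E <= v (cemb L (in_alg K (exp_coef k i)) * g ^+ (#|k| ^ i))%R)%E.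
Proof.
move=> eN; have q_gt0 : (0 < #|k| ^ i)%N by rewrite expn_gt0; apply/orP; left; exact: ltnW (card_gt1 k).
have [->|g0] := eqVneq g 0; first by move=> _; rewrite expr0n gtn_eqF // mulr0 (dval0 vP) leey.
have [b vg] := dval_fin vP g0.
rewrite (dvalM vP) cval_emb ord_exp_coef (dvalX vP _ vg) vg -EFinD !lee_fin => Nb.
case: i q_gt0 => [|i]; first by rewrite mul0n mulr0n add0r expn0 mulr1n addr0.
move: (#|k| ^ _)%N => Q Q_gt0.
have -> : e *+ (i.+1 * Q) + b *+ Q = (e *+ i + (e + b)) *+ Q.
  by rewrite mulrnA -mulrnDl mulrSr addrA.
have ei : i%:Z <= e *+ i by rewrite pmulrn -mulrzr intz ler_peMl // -gtz0_ge1.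
apply: (@le_trans _ _ (e *+ i + (e + b))); first by lia.
rewrite -[X in X <= _]mulr1n; apply: ler_wpMn2l => //.
by lia.
Qed.

Lemma exp_partial_sub_ge g N m n : - e <= N -> (N%:E <= v g)%E -> (m <= n)%N ->
  ((N + m%:Z)%:E <= v (exp_partial g n - exp_partial g m)%R)%E.
Proof.
move=> eN Ng mn; rewrite /exp_partial -!(big_mkord xpredT
  (fun i => cemb L (in_alg K (exp_coef k i)) * g ^+ (#|k| ^ i))).
rewrite (big_cat_nat (leq0n m) mn) /= addrAC subrr add0r big_seq_cond.
apply: (dval_ge_sum vP) => i; rewrite mem_index_iota => /andP[/andP[mi _] _].
by apply: le_trans (exp_term_ge i eN Ng); rewrite lee_fin; lia.
Qed.

(** The series converges on the ball, and its terms of positive index do not affect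
    the leading behaviour of its sum. *)
Lemma exp_ball g N : - e <= N -> (N%:E <= v g)%E ->
  exists2 y, is_exp g y & ((N + 1)%:E <= v (y - g)%R)%E.
Proof.
move=> eN Ng.
have ge_sub m n M : (`|M - N|%N <= m)%N -> (m <= n)%N ->
    (M%:E <= v (exp_partial g n - exp_partial g m)%R)%E.
  move=> Mm mn; apply: le_trans (exp_partial_sub_ge eN Ng mn).
  by rewrite lee_fin; lia.
have [|y gy] := @cfield_complete K z L (exp_partial g).
  move=> M; exists `|M - N|%N => m n mM nM.
  by have [mn|/ltnW nm] := leqP m n; [rewrite -(dvalN vP) opprB|]; exact: ge_sub.
exists y => //; have [n0 /(_ (maxn n0 1) (leq_maxl _ _)) gy1] := gy (N + 1).
have := exp_partial_sub_ge eN Ng (leq_maxr n0 1).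
have -> : exp_partial g 1 = g.
  by rewrite /exp_partial big_ord1 expn0 expr1 (_ : exp_coef k 0 = 1) // !rmorph1 mul1r.
move=> /(dval_geB vP) /(_ gy1); set P := exp_partial g _.
by rewrite (_ : P - g - (P - y) = y - g) //; ring.
Qed.

Lemma is_expN g y : is_exp g y -> is_exp (- g) (- y).
Proof.
by move/(is_expC (-1)); rewrite polyCN polyC1 rmorphN rmorph1 !mulN1r.
Qed.

Lemma exp_ge g y N : - e <= N -> (N%:E <= v g)%E -> is_exp g y -> (N%:E <= v y)%E.
Proof.
move=> eN Ng gy; have [y' gy' y'g] := exp_ball eN Ng.
rewrite (vcvg_unique vP gy gy') -(subrK g y'); apply: (dval_ge0D vP) => //.
by apply: le_trans y'g; rewrite lee_fin lerDl.
Qed.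

Lemma ge_exp g y N : ((- e)%:E <= v g)%E -> is_exp g y -> (N%:E <= v y)%E -> (N%:E <= v g)%E.
Proof.
move=> eg gy Ny; rewrite leNgt; apply/negP => gN.
have [n vg] : exists n, v g = n%:E.
  by apply: (dval_fin vP); apply: contraTneq gN => ->; rewrite (dval0 vP) ltNge leey.
move: eg gN; rewrite vg lee_fin lte_fin => en nN.
have [|y' gy'] := @exp_ball g n en; first by rewrite vg.
rewrite (vcvg_unique vP gy' gy) => yg.
have : ((n + 1)%:E <= v y)%E by apply: le_trans Ny; rewrite lee_fin lezD1.
by move=> /(dval_geB vP) /(_ yg); rewrite subKr vg lee_fin; lia.
Qed.

Lemma exp_inj g h y : ((- e)%:E <= v g)%E -> ((- e)%:E <= v h)%E ->
  is_exp g y -> is_exp h y -> g = h.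
Proof.
move=> eg eh gy hy; apply/eqP; rewrite -subr_eq0; apply/eqP/(dval_inf vP) => N.
apply: (@ge_exp _ 0); [exact: (dval_geB vP)| |by rewrite (dval0 vP) leey].
by rewrite -(subrr y); apply: is_expD => //; exact: is_expN.
Qed.

(** Successive approximation: replacing g by g + (y - exp g) improves the error from
    d = y - exp g to d - exp d, of larger valuation. *)
Lemma exp_surj y : ((- e)%:E <= v y)%E -> exists2 g, ((- e)%:E <= v g)%E & is_exp g y.
Proof.
move=> ey; pose E g := xget 0 [set y | is_exp g y].
have EP g : ((- e)%:E <= v g)%E -> is_exp g (E g).
  by move=> /(exp_ball (lexx _))[x gx _]; exact: (xgetPex 0 (ex_intro _ x gx)).
pose g := fix g n := if n is m.+1 then g m + (y - E (g m)) else 0.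
have gP n : ((- e)%:E <= v (g n))%E /\ ((- e + n%:Z)%:E <= v (y - E (g n))%R)%E.
  elim: n => [|n [eg Dg]] /=.
    rewrite (dval0 vP) leey addr0; split=> //.
    by rewrite (vcvg_unique vP (EP 0 _) (is_exp0 L)) ?subr0 // (dval0 vP) leey.
  have eD : ((- e)%:E <= v (y - E (g n))%R)%E by apply: le_trans Dg; rewrite lee_fin lerDl.
  have egD : ((- e)%:E <= v (g n + (y - E (g n)))%R)%E by exact: (dval_ge0D vP).
  split=> //; have [|x Dx xD] := @exp_ball (y - E (g n)) (- e + n%:Z) _ Dg.
    by rewrite lerDl.
  rewrite (vcvg_unique vP (EP _ egD) (is_expD (EP _ eg) Dx)) opprD addrA -(dvalN vP) opprB.
  by apply: le_trans xD; rewrite lee_fin; lia.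
have gD m n : (m <= n)%N -> ((- e + m%:Z)%:E <= v (g n - g m)%R)%E.
  move=> mn; rewrite -(subnKC mn); elim: (n - m)%N => [|j IHj].
    by rewrite addn0 subrr (dval0 vP) leey.
  rewrite addnS /= addrAC; apply: (dval_ge0D vP IHj).
  by apply: le_trans (gP _).2; rewrite lee_fin; lia.
have [|h gh] := @cfield_complete K z L g.
  move=> N; exists `|(N + e)%R|%N => m n mN nN.
  have [mn|/ltnW nm] := leqP m n; [rewrite -(dvalN vP) opprB|];
    by apply: le_trans (gD _ _ _); last eassumption; rewrite lee_fin; lia.
have eh : ((- e)%:E <= v h)%E by apply: (vcvg_ge vP gh) => n; exact: (gP n).1.
exists h => //; suff -> : y = E h by exact: EP.
apply/eqP; rewrite -subr_eq0; apply/eqP/(dval_inf vP) => N.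
pose M := Num.max N (- e).
have [n0 n0P] := gh M; pose n := maxn n0 `|(N + e)%R|%N.
have ghn := n0P n (leq_maxl _ _); have [egn Dgn] := gP n.
have := exp_ge _ ghn (is_expD (EP _ egn) (is_expN (EP _ eh))).
rewrite le_max lexx orbT => /(_ isT) /(le_trans (_ : (N%:E <= M%:E)%E)).
rewrite lee_fin le_max lexx => /(_ isT) NE.
rewrite -(subrK (E (g n)) y) -addrA; apply: (dval_ge0D vP) => //.
by apply: le_trans Dgn; rewrite lee_fin /n; lia.
Qed.

Let tE : cval (AtoL L 'X) = (- e)%:E.
Proof. by rewrite cval_emb -[X in z X]/(tK K) zt. Qed.

Lemma carlitz_logP y : ((- e)%:E <= v y)%E ->
  ((- e)%:E <= v (carlitz_log y))%E /\ is_exp (carlitz_log y) y.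
Proof.
move=> /exp_surj[g eg gy].
have /(xgetPex 0) : exists g, (cval (AtoL L 'X) <= cval g)%E /\ is_exp g y.
  by exists g; rewrite tE.
by rewrite -tE.
Qed.

Lemma carlitz_logE g y : ((- e)%:E <= v g)%E -> is_exp g y -> carlitz_log y = g.
Proof.
move=> eg gy; have [el ly] := carlitz_logP (exp_ge (lexx _) eg gy).
exact: exp_inj el eg ly gy.
Qed.

End ExpInfinity.

(** * The two maps *)

Section CarlitzEval.
Variables (k : finFieldType) (K : fieldExtType (ratfun k)).
Variables (M : lmodType {poly k}) (D : K -> Prop) (lam : K -> M).
Implicit Types (p q : {poly K}) (a : {poly k}).
Local Notation AtoK := (@AtoK k K).

(** The A-linear extension of lam to polynomials, T acting on M as t.  The map lam is only
    assumed to be k-linear on the coefficients allowed by D, as logarithms are k-linear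
    on the sections of O_X(oo) only. *)
Definition carlitz_ev p : M := \sum_(i < size p) 'X^i *: lam p`_i.

Variables (D0 : D 0) (DD : forall f g, D f -> D g -> D (f + g))
  (DC : forall c f, D f -> D (AtoK c%:P * f))
  (lamD : forall f g, D f -> D g -> lam (f + g) = lam f + lam g)
  (lamC : forall c f, D f -> lam (AtoK c%:P * f) = c%:P *: lam f).
Local Notation over p := (forall i, D p`_i).

Let lam0 : lam 0 = 0.
Proof. by apply: (addrI (lam 0)); rewrite -lamD // !addr0. Qed.

Lemma carlitz_evE N p : (size p <= N)%N -> carlitz_ev p = \sum_(i < N) 'X^i *: lam p`_i.
Proof.
move=> pN; rewrite /carlitz_ev (big_ord_widen N (fun i => 'X^i *: lam p`_i) pN) big_mkcond.
by apply: eq_bigr => i _; case: ltnP => // pi; rewrite nth_default // lam0 scaler0.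
Qed.

Lemma carlitz_evD p q : over p -> over q -> carlitz_ev (p + q) = carlitz_ev p + carlitz_ev q.
Proof.
move=> pD qD; pose N := maxn (size p) (size q).
rewrite !(@carlitz_evE N) ?leq_maxl ?leq_maxr ?size_polyD // -big_split.
by apply: eq_bigr => i _ /=; rewrite coefD lamD // scalerDr.
Qed.

Lemma carlitz_evC c : carlitz_ev c%:P = lam c.
Proof.
rewrite (@carlitz_evE 1) ?size_polyC; last by case: (_ == _).
by rewrite big_ord1 coefC scale1r.
Qed.

Lemma carlitz_evX p : carlitz_ev (p * 'X) = 'X *: carlitz_ev p.
Proof.
rewrite (@carlitz_evE (size p).+1); last first.
  by have [->|p0] := eqVneq p 0; rewrite ?mul0r ?size_poly0 // size_mulX.
rewrite big_ord_recl coefMX eqxx lam0 scaler0 add0r /carlitz_ev scaler_sumr.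
by apply: eq_bigr => i _; rewrite coefMX /= scalerA exprS.
Qed.

Lemma carlitz_evZC c p : over p -> carlitz_ev ((AtoK c%:P)%:P * p) = c%:P *: carlitz_ev p.
Proof.
move=> pD; rewrite (@carlitz_evE (size p)); last by rewrite mul_polyC size_scale_leq.
rewrite /carlitz_ev scaler_sumr; apply: eq_bigr => i _.
by rewrite coefCM lamC // !scalerA mulrC.
Qed.

Lemma over_polyAtoK a p : over p -> over (polyAtoK K a * p).
Proof.
move=> pD i; rewrite coefM; elim/big_ind: _ => // j _.
by rewrite coef_map; exact: DC.
Qed.

Lemma carlitz_evZ a p : over p -> carlitz_ev (polyAtoK K a * p) = a *: carlitz_ev p.
Proof.
elim/poly_ind: a p => [|a c IHa] p pD.
  by rewrite rmorph0 mul0r -polyC0 carlitz_evC lam0 scale0r.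
rewrite rmorphD rmorphM /= map_polyX map_polyC mulrDl carlitz_evD.
- by rewrite mulrAC carlitz_evX IHa // carlitz_evZC // scalerA scalerDl [a * _]mulrC.
- rewrite mulrAC => i; rewrite coefMX; case: ifP => // _.
  exact: over_polyAtoK.
- by move=> i; rewrite coefCM; exact: DC.
Qed.

(** Horner's scheme: the values at the tails of p are the successive partial
    results, hence the coefficients of the quotient of p by T - t. *)
Lemma carlitz_ev_drop p i : over p ->
  carlitz_ev (drop_poly i p) = lam p`_i + 'X *: carlitz_ev (drop_poly i.+1 p).
Proof.
move=> pD; have {1}-> : drop_poly i p = (p`_i)%:P + drop_poly i.+1 p * 'X.
  apply/polyP => j; rewrite coefD coefC coefMX !coef_drop_poly.
  by case: j => [|j] /=; rewrite ?addr0 ?add0r // addnS addSn.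
rewrite carlitz_evD ?carlitz_evC ?carlitz_evX // => j.
  by rewrite coefC; case: ifP.
by rewrite coefMX coef_drop_poly; case: ifP.
Qed.

Lemma carlitz_ev_boundary (p q : {poly K}) : over p -> over q ->
  (forall i, lam q`_i = 'X *: lam p`_i) -> carlitz_ev (p * 'X - q) = 0.
Proof.
move=> pD qD qp.
have qE : carlitz_ev q = 'X *: carlitz_ev p.
  pose N := maxn (size p) (size q).
  rewrite !(@carlitz_evE N) ?leq_maxl ?leq_maxr // scaler_sumr.
  by apply: eq_bigr => i _; rewrite qp !scalerA mulrC.
have N1 : - q = (AtoK (-1)%:P)%:P * q by rewrite polyCN polyC1 rmorphN rmorph1 polyCN mulN1r.
rewrite N1 carlitz_evD ?carlitz_evX ?carlitz_evZC //.
- by rewrite qE polyCN polyC1 scaleN1r subrr.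
- by move=> i; rewrite coefMX; case: ifP.
- by move=> i; rewrite coefCM; exact: DC.
Qed.

End CarlitzEval.

Section Maps.
Variables (k : finFieldType) (K : fieldExtType (ratfun k)).
Implicit Types (p q : {poly K}) (a : {poly k}) (z : place K) (U V : opens (curve K)).
Local Notation AtoK := (@AtoK k K).
Local Notation phi := (carlitz_t AtoK).

Lemma carlitz_act_X (R : comNzRingType) (alg : {rmorphism {poly k} -> R}) (c : R) :
  carlitz_act alg 'X c = carlitz_t alg c.
Proof. by rewrite -['X]mul1r carlitz_actMX carlitz_act1. Qed.

Definition carlitz_boundary p : {poly K} := p * 'X - map_poly phi p.

Lemma coef_carlitz_boundary p i :
  (carlitz_boundary p)`_i = (if i is j.+1 then p`_j else 0) - phi p`_i.
Proof.
rewrite coefB coefMX coef_map_id0; last exact: carlitz_t0.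
by case: i.
Qed.

Lemma carlitz_boundary_lin a p q :
  carlitz_boundary (polyAtoK K a * p + q) = polyAtoK K a * carlitz_boundary p + carlitz_boundary q.
Proof.
have phiE : map_poly phi (polyAtoK K a * p + q) = polyAtoK K a * map_poly phi p + map_poly phi q.
  apply/polyP => i; rewrite coefD !coef_map_id0 ?coefD ?carlitz_tD; try exact: carlitz_t0.
  congr (_ + _); rewrite !coefM (carlitz_t_sum _ _ (fun j => (polyAtoK K a)`_j * p`_(i - j))).
  apply: eq_bigr => j _; rewrite coef_map coef_map_id0; last exact: carlitz_t0.
  exact: carlitz_tZ.
by rewrite /carlitz_boundary phiE; ring.
Qed.

(** The leading coefficient of T p - phi(p) is that of p. *)
Lemma carlitz_boundary_inj p : carlitz_boundary p = 0 -> p = 0.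
Proof.
move=> dp; apply/eqP; rewrite -lead_coef_eq0 lead_coefE; apply/eqP.
have := coef_carlitz_boundary p (size p); rewrite dp coef0.
rewrite [p`_(size p)]nth_default // carlitz_t0 subr0.
by have [->|p0] := eqVneq p 0; rewrite ?coef0 // polySpred.
Qed.

Lemma regular_secN n (U : set (curve K)) f : regular_sec n U f -> regular_sec n U (- f).
Proof. by move/(regular_secZ (-1)); rewrite polyCN polyC1 rmorphN rmorph1 mulN1r. Qed.

Lemma regular_sec1 (U : set (curve K)) f : regular_sec 0 U f -> regular_sec 1 U f.
Proof.
move=> [fU f0]; split=> // z zU; have [fY fNY] := fU z zU; split=> // nY.
have [e e0 zt] := (not_affineP z).1 nY; have zP := ord_dval z.
have := fNY nY; rewrite divr1 (dvalM zP) (dval_inv zP zt) opprK => f_ge0.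
by apply: adde_ge0; rewrite // lee_fin ltW.
Qed.

Lemma regular_sec_carlitz_t (U : set (curve K)) f :
  regular_sec 0 U f -> regular_sec 1 U (phi f).
Proof.
move=> [fU f0]; split=> [z zU|U0]; last by rewrite f0 // carlitz_t0.
have [fY fNY] := fU z zU; have zP := ord_dval z; split=> zY.
  have f_ge0 := fY zY; apply: (dval_ge0D zP); last exact: (dval_ge0X zP).
  exact: (dval_ge0M zP (zY 'X)).
have [e e0 zt] := (not_affineP z).1 zY.
have f_ge0 := fNY zY; rewrite divr1 in f_ge0.
have zV : (0 <= z (tK K)^-1%R)%E by rewrite (dval_inv zP zt) opprK lee_fin ltW.
rewrite mulrDl; apply: (dval_ge0D zP).
  by rewrite mulrAC divff ?mul1r // AtoK_eq0 polyX_eq0.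
by apply: (dval_ge0M zP) => //; exact: (dval_ge0X zP).
Qed.

Lemma carlitz_boundaryP (U : set (curve K)) p : tw_set 0 U p -> tw_set 1 U (carlitz_boundary p).
Proof.
move=> pU i; rewrite coef_carlitz_boundary; apply: regular_secD.
  by case: i => [|i]; [exact: regular_sec0|exact: regular_sec1].
by apply: regular_secN; exact: regular_sec_carlitz_t.
Qed.

Definition partial_app U (s : tw_sec 0 U) : tw_sec 1 U :=
  SubmodElt (carlitz_boundaryP (sm_valP s) : tw_mod 1 U _).

Fact partial_linear U : linear (@partial_app U).
Proof. by move=> a s s'; apply: sm_val_inj; exact: carlitz_boundary_lin. Qed.

HB.instance Definition _ U := GRing.isLinear.Build {poly k} _ _ _
  (@partial_app U) (@partial_linear U).

Fact partial_natural U V (VU : V `<=` U) (s : tw_sec 0 U) :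
  partial_app (tw_res VU s) = tw_res VU (partial_app s).
Proof.
apply: sm_val_inj => /=; have [V0|V0] := nonempty_or_set0 V; first by rewrite !cut_id.
by rewrite !cut_set0 // /carlitz_boundary mul0r map_poly0 subrr.
Qed.

Definition partial_hom : sheaf_hom (twisted K 0) (twisted K 1) :=
  @SheafHom _ _ (twisted K 0) (twisted K 1) (fun U => @partial_app U) partial_natural.

End Maps.

Section LogMap.
Variables (k : finFieldType) (K : fieldExtType (ratfun k)).
Variable Kz : forall z : place K, completion z.
Implicit Types (p q : {poly K}) (a : {poly k}) (U V : opens (curve K)).
Local Notation AtoK := (@AtoK k K).
Local Notation phi := (carlitz_t AtoK).

Definition log_sec (U : set (curve K)) (f : K) : C_amb Kz U :=
  (f : carlitz AtoK,
   (fun z => carlitz_log (cemb (Kz (sval z)) f)) : dprod (fun z : outY U => Kz_mod Kz (sval z))).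

Lemma regular_sec1_ge (U : set (curve K)) f (z : outY U) (e : int) : regular_sec 1 U f ->
  sval z (tK K) = (- e)%:E -> ((- e)%:E <= cval (cemb (Kz (sval z)) f))%E.
Proof.
case: z => z [zU nY] /= [fU _] zt; have [_ /(_ nY)] := fU z zU.
have zP := ord_dval z; rewrite expr1 (dvalM zP) (dval_inv zP zt) opprK cval_emb.
by case: (z f) => [n| |]; rewrite ?leey // -EFinD !lee_fin; lia.
Qed.

Lemma log_secD (U : set (curve K)) f g : regular_sec 1 U f -> regular_sec 1 U g ->
  log_sec U (f + g) = log_sec U f + log_sec U g.
Proof.
move=> fU gU; congr pair; apply: functional_extensionality_dep => z.
have [e e0 zt] := (not_affineP (sval z)).1 (svalP z).2.
have [lf fl] := carlitz_logP e0 zt (regular_sec1_ge fU zt).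
have [lg gl] := carlitz_logP e0 zt (regular_sec1_ge gU zt).
rewrite rmorphD; apply: (carlitz_logE e0 zt _ (is_expD fl gl)).
exact: (dval_ge0D (cval_dval _)).
Qed.

Lemma log_secC (U : set (curve K)) c f : regular_sec 1 U f ->
  log_sec U (AtoK c%:P * f) = c%:P *: log_sec U f.
Proof.
move=> fU; congr pair; first exact/esym/carlitz_actC.
apply: functional_extensionality_dep => z.
have [e e0 zt] := (not_affineP (sval z)).1 (svalP z).2.
have [lf fl] := carlitz_logP e0 zt (regular_sec1_ge fU zt).
rewrite rmorphM; apply: (carlitz_logE e0 zt _ (is_expC c fl)).
by apply: (dval_leMl (cval_dval _)) => //; exact: AtoL_const_ge0.
Qed.

(** Integrality of f keeps t log f in the ball {v >= v(t)}, where exp is injective. *)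
Lemma log_sec_carlitz_t (U : set (curve K)) f : regular_sec 0 U f ->
  log_sec U (phi f) = 'X *: log_sec U f.
Proof.
move=> fU; congr pair.
  exact/esym/carlitz_act_X.
apply: functional_extensionality_dep => z.
have [e e0 zt] := (not_affineP (sval z)).1 (svalP z).2.
have vP := cval_dval (Kz (sval z)).
have f_ge0 : (0%:E <= cval (cemb (Kz (sval z)) f))%E.
  have [_ /(_ (svalP z).2)] := fU.1 _ (svalP z).1.
  by rewrite divr1 cval_emb.
have e_le0 : ((- e)%:E <= 0%:E :> \bar int)%E by rewrite lee_fin oppr_le0 ltW.
have [lf fl] := carlitz_logP e0 zt (le_trans e_le0 f_ge0).
have lf_ge0 := ge_exp e0 zt lf fl f_ge0.
have -> : cemb (Kz (sval z)) (phi f) = carlitz_t (AtoL (Kz (sval z))) (cemb (Kz (sval z)) f).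
  by rewrite /carlitz_t rmorphD rmorphM rmorphXn.
apply: (carlitz_logE e0 zt _ (is_exp_t fl)).
have tE : cval (AtoL (Kz (sval z)) 'X) = (- e)%:E by rewrite cval_emb -zt.
by rewrite (dvalM vP) tE -[leLHS]adde0 leeD.
Qed.

Lemma regular_sec_affine U f : regular_sec 1 U f -> regular_sec 0 (U `&` @affineY k K) f.
Proof.
move=> [fU f0]; split=> [z [zU zY]|UY]; first by split=> // _; exact: (fU z zU).1.
have [[x Ux]|/f0//] := nonempty_or_set0 U.
have : (oset U `&` @affineY k K) (Generic _) by split=> //; exact: open_generic Ux.
by rewrite UY.
Qed.

Lemma log_secP U f : regular_sec 1 U f -> C_mod Kz U (log_sec U f).
Proof.
move=> fU; split=> [|z] /=; first exact: regular_sec_affine.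
have [e e0 zt] := (not_affineP (sval z)).1 (svalP z).2.
by have [] := carlitz_logP e0 zt (regular_sec1_ge fU zt).
Qed.

Lemma pi_subproof U p : tw_set 1 U p -> C_mod Kz U (carlitz_ev (log_sec U) p).
Proof.
move=> pU; apply: (big_ind (fun s => C_mod Kz U s)); first exact: sm_0.
  by move=> s s'; exact: sm_addP.
by move=> i _; apply: sm_scaleP; apply: log_secP; exact: pU.
Qed.

Definition pi_app U (s : tw_sec 1 U) : C_sec Kz U := SubmodElt (pi_subproof (sm_valP s)).

Fact pi_linear U : linear (@pi_app U).
Proof.
move=> a s s'; apply: sm_val_inj => /=.
have sZ := over_polyAtoK (regular_sec0 1 U) (@regular_secD _ _ 1 U) (@regular_secZ _ _ 1 U)
  a (sm_valP s).
apply: etrans (carlitz_evD (regular_sec0 1 U) (@log_secD U) sZ (sm_valP s')) _.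
congr (_ + _); apply: (carlitz_evZ (regular_sec0 1 U)); last exact: (sm_valP s).
- exact: regular_secD.
- exact: regular_secZ.
- exact: log_secD.
- exact: log_secC.
Qed.

HB.instance Definition _ U := GRing.isLinear.Build {poly k} _ _ _
  (@pi_app U) (@pi_linear U).

Fact pi_natural U V (VU : V `<=` U) (s : tw_sec 1 U) :
  pi_app (tw_res VU s) = C_res VU (pi_app s).
Proof.
have [V0|V0] := nonempty_or_set0 V; last first.
  apply: C_sec_eq => [|[z [zV nY]]]; first by rewrite !C_sec_empty.
  by exfalso; have := zV; rewrite V0.
have sndE (U' : opens (curve K)) (q : {poly K}) (z : outY U') :
    (carlitz_ev (log_sec U') q).2 z =
    \sum_(i < size q) 'X^i *: (carlitz_log (cemb (Kz (sval z)) q`_i) : Kz_mod Kz (sval z)).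
  by apply: (big_morph (fun s : C_amb Kz U' => s.2 z)).
have fstE (U' : opens (curve K)) (q : {poly K}) :
    (carlitz_ev (log_sec U') q).1 = \sum_(i < size q) 'X^i *: (q`_i : carlitz AtoK).
  by apply: (big_morph (fun s : C_amb Kz U' => s.1)).
apply: C_sec_eq => [|z] /=; first by rewrite !cut_id // !fstE.
by rewrite !sndE cut_id.
Qed.

Definition pi_hom : sheaf_hom (twisted K 1) (sheafC Kz) :=
  @SheafHom _ _ (twisted K 1) (sheafC Kz) (fun U => @pi_app U) pi_natural.

End LogMap.

(** * Exactness *)

Section Exactness.
Variables (k : finFieldType) (K : fieldExtType (ratfun k)).
Variable Kz : forall z : place K, completion z.
Implicit Types (p q : {poly K}) (a : {poly k}) (U V : opens (curve K)).
Local Notation AtoK := (@AtoK k K).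
Local Notation phi := (carlitz_t AtoK).
Local Notation affineY := (@affineY k K).

Lemma partial_tens U f (fU : regular_sec 0 U f) a :
  sm_val (partial_hom K U (tens_sec fU a)) = tens f ('X * a) - tens (phi f) a.
Proof.
rewrite /= /carlitz_boundary /tens rmorphM /= map_polyX -mulrA [polyAtoK K a * _]mulrC.
congr (_ - _); apply/polyP => i; rewrite coef_map_id0; last exact: carlitz_t0.
by rewrite !coefCM coef_map mulrC [RHS]mulrC; exact: carlitz_tZ.
Qed.

Lemma regular_sec_split U f : oset U !=set0 -> regular_sec 0 (U `&` affineY) f ->
  (forall z, oset U (ClosedPt z) -> ~ affineY (ClosedPt z) -> (0 <= z f)%E) ->
  regular_sec 0 U f.
Proof.
move=> U0 [fY _] fNY; split=> [z zU|UE]; last by case: U0 => x; rewrite UE.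
by split=> zY; [exact: (fY z _).1|rewrite divr1; exact: fNY].
Qed.

Lemma pi_partial U (s : tw_sec 0 U) : pi_app Kz (partial_app s) = 0.
Proof.
apply: sm_val_inj; apply: (carlitz_ev_boundary (regular_sec0 1 U)).
- exact: regular_secZ.
- exact: log_secD.
- exact: log_secC.
- by move=> i; apply: regular_sec1; exact: (sm_valP s).
- move=> i; rewrite coef_map_id0; last exact: carlitz_t0.
  by apply: regular_sec_carlitz_t; exact: (sm_valP s).
- move=> i; rewrite coef_map_id0; last exact: carlitz_t0.
  by apply: log_sec_carlitz_t; exact: (sm_valP s).
Qed.

(** The coefficients of the preimage are the first components of the Horner results Q_i.
    They are regular on Y because Q_i is a section of C, and integral above infinity
    because their logarithms, the other components, are: t Q_(i+1) = Q_i - log p_i lies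
    in the ball {v >= -e} as soon as Q_i is integral. *)
Lemma pi_kernel U (s : tw_sec 1 U) : pi_app Kz s = 0 -> exists r, partial_app r = s.
Proof.
have [U0|UE] := nonempty_or_set0 U; last first.
  move=> _; exists 0; rewrite linear0; apply: sm_val_inj; apply/polyP => i.
  by rewrite coef0; have [_ ->] := sm_valP s i.
move=> /(congr1 (@sm_val _ _ _)) /= ps0; set p : {poly K} := sm_val s in ps0.
have pU : tw_set 1 U p := sm_valP s.
pose Q i := carlitz_ev (log_sec Kz U) (drop_poly i p).
have QP i : C_mod Kz U (Q i).
  by apply: pi_subproof => j; rewrite coef_drop_poly; exact: pU.
have Q0 : Q 0%N = 0 by rewrite /Q drop_poly0l.
have QS i : Q i = log_sec Kz U p`_i + 'X *: Q i.+1.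
  by apply: (carlitz_ev_drop (regular_sec0 1 U) (@log_secD _ _ _ U)).
have Q_ge0 i (z : outY U) : (0%:E <= cval ((Q i).2 z : Kz (sval z)))%E.
  have [e e0 zt] := (not_affineP (sval z)).1 (svalP z).2.
  have vP := cval_dval (Kz (sval z)).
  have tE : cval (AtoL (Kz (sval z)) 'X) = (- e)%:E by rewrite cval_emb -zt.
  elim: i => [|i IHi]; first by rewrite Q0 (dval0 vP) leey.
  have := congr1 (fun s : C_amb Kz U => s.2 z : Kz (sval z)) (QS i) => /= QSz.
  have [lp _] := carlitz_logP e0 zt (regular_sec1_ge Kz (pU i) zt).
  have e_le0 : ((- e)%:E <= 0%:E :> \bar int)%E by rewrite lee_fin oppr_le0 ltW.
  have : ((- e)%:E <= cval (AtoL (Kz (sval z)) 'X * ((Q i.+1).2 z : Kz (sval z)))%R)%E.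
    rewrite -[X in cval X](addKr (carlitz_log (cemb (Kz (sval z)) p`_i))).
    rewrite addrC; apply: (dval_geB vP) => //.
    by apply: le_trans e_le0 _; rewrite -[X in cval X]QSz.
  rewrite (dvalM vP) tE; case: (cval _) => [n| |]; rewrite ?leey // -EFinD !lee_fin.
  by lia.
have QQ i : (size p <= i)%N -> Q i = 0.
  by move=> pi; rewrite /Q drop_poly_eq0 // /carlitz_ev size_poly0 big_ord0.
pose r : {poly K} := \poly_(i < size p) (Q i.+1).1.
have rE i : r`_i = (Q i.+1).1.
  by rewrite coef_poly; case: ltnP => // pi; rewrite QQ // leqW.
have rU : tw_set 0 U r.
  move=> i; rewrite rE; apply: regular_sec_split => //; first exact: (QP i.+1).1.
  move=> z zU zY; pose z' : outY U := exist _ z (conj zU zY).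
  have [e e0 zt] := (not_affineP z).1 zY.
  rewrite -(cval_emb (Kz z)).
  by apply: (exp_ge e0 zt _ (Q_ge0 i.+1 z') ((QP i.+1).2 z')); rewrite oppr_le0 ltW.
exists (SubmodElt (rU : tw_mod 0 U r)); apply: sm_val_inj => /=.
apply/polyP => i; rewrite coef_carlitz_boundary !rE.
have /(congr1 (fun s : C_amb Kz U => s.1)) /= := QS i.
rewrite -[('X *: _ : carlitz _)]/(carlitz_act _ 'X _) carlitz_act_X => QSi.
have -> : (if i is j.+1 then r`_j else 0) = (Q i).1.
  by case: (i) => [|j]; rewrite ?rE // Q0.
by rewrite QSi addrK.
Qed.

Lemma pi_exact U (s : twisted K 1 U) :
  pi_hom Kz U s = 0 <-> locally_in_image (partial_hom K) s.
Proof.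
split=> [/pi_kernel[r rs] x Ux|s_loc].
  exists U, (@subset_refl _ U); split=> //; exists r.
  by rewrite res_id.
have H (x : {x | oset U x}) := cid (s_loc (sval x) (svalP x)).
pose W x := sval (H x).
have WP x : exists WU : W x `<=` U, oset (W x) (sval x) /\
    exists r, partial_hom K (W x) r = tw_res WU s := svalP (H x).
have WU x : W x `<=` U by have [] := WP x.
apply: (@sheaf_sep _ _ (sheafC Kz) U {x | oset U x} W WU) => [x Ux|x].
  by exists (exist _ x Ux) => //; have [? []] := WP (exist _ x Ux).
rewrite linear0 -(hom_nat (pi_hom Kz)); have [WU' [_ [r rs]]] := WP x.
rewrite [X in pi_hom Kz _ X](_ : _ = partial_app r); first exact: pi_partial.
by rewrite -[RHS]/(partial_hom K _ r) rs (Prop_irrelevance WU' (WU x)).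
Qed.

Lemma open_cofinite (P : set (curve K)) : P (Generic K) -> finite_set (~` P) -> open P.
Proof. by move=> PG Pf; rewrite open_curveE; right. Qed.

Lemma open_affineY : open affineY.
Proof.
apply: open_cofinite => //.
apply: sub_finite_set (finite_image (@ClosedPt k K) (@finite_infinite k K)).
by move=> [[]//|z zY]; exists z.
Qed.

(** On the intersection of U with Y, the component c of s is the image of the constant
    polynomial c. *)
Lemma pi_surj_affine U (s : C_sec Kz U) x : oset U x -> affineY x ->
  exists V (VU : V `<=` U), oset V x /\ exists r, pi_app Kz r = C_res VU s.
Proof.
move=> Ux xY; pose V := Opens (openI (osetP U) open_affineY).
exists V, (@subIsetl _ _ _); split=> //.
have [s1 _] := sm_valP s; set c := (sm_val s).1 in s1.
have cV : tw_set 1 V c%:P.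
  move=> i; rewrite coefC; case: ifP => _; last exact: regular_sec0.
  exact: regular_sec1.
exists (SubmodElt (cV : tw_mod 1 V _)); apply: C_sec_eq => [|[z [[_ zY] nzY]]] //=.
rewrite (carlitz_evC (regular_sec0 1 V) (@log_secD _ _ _ V)) cut_id //.
by exists x.
Qed.

(** Choose N such that g / t^N is integral, and f in K within t^-N of
    exp (g / t^N); as exp is an isometry, log f is equally close to g / t^N. *)
Lemma exists_log_approx (z : place K) e (g : Kz z) : 0 < e -> z (tK K) = (- e)%:E ->
  exists N f, (0 <= z f)%E /\
    (0%:E <= cval (g - AtoL (Kz z) 'X ^+ N * carlitz_log (cemb (Kz z) f))%R)%E.
Proof.
move=> e0 zt; have vP := cval_dval (Kz z); set T := AtoL _ _.
have tE : cval T = (- e)%:E by rewrite cval_emb -zt.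
have e_le0 : - e <= 0 by rewrite oppr_le0 ltW.
have [N gN] : exists N : nat, (0%:E <= cval (g / T ^+ N)%R)%E.
  have [->|g0] := eqVneq g 0; first by exists 0%N; rewrite mul0r (dval0 vP) leey.
  have [b vg] := dval_fin vP g0; exists `|b|%N.
  rewrite (dval_div vP vg (dvalX vP _ tE)) lee_fin pmulrn -mulrzr intz.
  by nia.
have [y gy _] := exp_ball e0 zt e_le0 gN.
have y_ge0 := exp_ge e0 zt e_le0 gN gy.
have [f yf] := cemb_dense y (e *+ N).
have eN : 0 <= e *+ N by rewrite mulrn_wge0 // ltW.
have yf_ge0 : (0%:E <= cval (y - cemb (Kz z) f)%R)%E by apply: le_trans yf; rewrite lee_fin.
have f_ge0 : (0%:E <= cval (cemb (Kz z) f))%E.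
  by have := dval_geB vP y_ge0 yf_ge0; rewrite subKr.
have ef : ((- e)%:E <= cval (cemb (Kz z) f))%E by apply: le_trans f_ge0; rewrite lee_fin.
have [lf fl] := carlitz_logP e0 zt ef.
exists N, f; split; first by rewrite -(cval_emb (Kz z)).
have T0 : T ^+ N != 0 by rewrite (dval_neq0 vP (dvalX vP N tE)).
rewrite -[X in X - _](divfK T0) [X in X - _]mulrC -mulrBr (dvalM vP) (dvalX vP N tE).
have := ge_exp e0 zt _ (is_expD gy (is_expN fl)) yf.
have eg : ((- e)%:E <= cval (g / T ^+ N)%R)%E by apply: le_trans gN; rewrite lee_fin.
move=> /(_ (dval_geB vP eg lf)); case: (cval _) => [n| |] //.
by rewrite -EFinD !lee_fin mulNrn; lia.
Qed.

(** A preimage is f T^N + h, with N and f such that gamma - t^N log f is integral and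
    h = c - phi^N(f): the exponential of this integral element is h, so h is integral
    at z and the element is log h. *)
Lemma pi_surj_infinite U (s : C_sec Kz U) z : oset U (ClosedPt z) -> ~ affineY (ClosedPt z) ->
  exists V (VU : V `<=` U), oset V (ClosedPt z) /\ exists r, pi_app Kz r = C_res VU s.
Proof.
move=> zU zY; have [e e0 zt] := (not_affineP z).1 zY.
have e_le0 : - e <= 0 by rewrite oppr_le0 ltW.
have vP := cval_dval (Kz z).
pose z0 : outY U := exist _ z (conj zU zY).
have [s1 /(_ z0) s2] := sm_valP s.
set c : K := (sm_val s).1 in s1 s2; set g : Kz z := (sm_val s).2 z0 in s2.
have [N [f [f_ge0 gf]]] := exists_log_approx g e0 zt.
pose h : K := c - carlitz_act AtoK 'X^N f.
set l := carlitz_log (cemb (Kz z) f) in gf.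
have [el fl] : ((- e)%:E <= cval l)%E /\ is_exp l (cemb (Kz z) f).
  by apply: (carlitz_logP e0 zt); rewrite cval_emb; apply: le_trans f_ge0; rewrite lee_fin.
set g' := g - _ in gf.
have g'h : is_exp g' (cemb (Kz z) h).
  rewrite rmorphB carlitz_act_morph; apply: is_expD => //; apply: is_expN.
  by have := is_expZ 'X^N fl; rewrite rmorphXn.
have h_ge0 : (0 <= z h)%E.
  by rewrite -(cval_emb (Kz z)); exact: (exp_ge e0 zt e_le0 gf g'h).
pose P : set (curve K) := [set x | match x with
  | Generic => True
  | ClosedPt w => w = z \/ affineY (ClosedPt w) /\ (0 <= w f)%E end].
have P_open : open P.
  apply: open_cofinite => //; apply: sub_finite_set (_ : finite_set
    (@ClosedPt k K @` ([set w | ~ affineY (ClosedPt w)] `|` [set w | (w f < 0)%E]))).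
    move=> [[]//|w wP]; exists w => //; have [wY|] := pselect (affineY (ClosedPt w)); last by left.
    by right; rewrite /= ltNge; apply/negP => wf; apply: wP; right.
  apply: finite_image; rewrite finite_setU; split; [exact: finite_infinite|exact: finite_poles].
pose V := Opens (openI (osetP U) P_open).
have zV : oset V (ClosedPt z) by split=> //; left.
have V0 : oset V !=set0 by exists (ClosedPt z).
have VG : oset V (Generic K) := open_generic zV.
have VY0 : oset V `&` affineY !=set0 by exists (Generic K); split.
have V_inf w : oset V (ClosedPt w) -> ~ affineY (ClosedPt w) -> w = z.
  by move=> [_ [//|[wY _]]] /(_ wY).
exists V, (@subIsetl _ _ _); split=> //.
have fVY : regular_sec 0 (V `&` affineY) f.
  split=> [w [[_ wP] wY]|VE]; last by case: VY0 => x; rewrite VE.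
  by split=> // _; case: wP => [->//|[]].
have fV : regular_sec 1 V f.
  by apply/regular_sec1/regular_sec_split => // w wV /(V_inf w wV) ->.
have hV : regular_sec 1 V h.
  apply/regular_sec1/regular_sec_split => // [|w wV /(V_inf w wV) -> //].
  apply: regular_secD.
    by apply: regular_sec_sub s1 => //; apply: setSI; exact: subIsetl.
  by apply/regular_secN/regular_carlitz => //; exact: subIsetr.
pose p : {poly K} := polyAtoK K 'X^N * f%:P + h%:P.
have fC i : regular_sec 1 V (f%:P)`_i.
  by rewrite coefC; case: ifP => _ //; exact: regular_sec0.
have hC i : regular_sec 1 V (h%:P)`_i.
  by rewrite coefC; case: ifP => _ //; exact: regular_sec0.
have fXC := over_polyAtoK (regular_sec0 1 V) (@regular_secD _ _ 1 V) (@regular_secZ _ _ 1 V)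
  'X^N fC.
have pV : tw_set 1 V p by move=> i; rewrite coefD; apply: regular_secD.
have evp : carlitz_ev (log_sec Kz V) p = 'X^N *: log_sec Kz V f + log_sec Kz V h.
  rewrite (carlitz_evD (regular_sec0 1 V) (@log_secD _ _ _ V) fXC hC).
  rewrite (carlitz_evZ (regular_sec0 1 V) (@regular_secD _ _ 1 V) (@regular_secZ _ _ 1 V)
    (@log_secD _ _ _ V) (@log_secC _ _ _ V) _ fC).
  by rewrite !(carlitz_evC (regular_sec0 1 V) (@log_secD _ _ _ V)).
exists (SubmodElt (pV : tw_mod 1 V p)); apply: C_sec_eq => [|[w [wV wY]]].
  by rewrite /= evp cut_id //= addrC subrK.
have wz := V_inf w wV wY; subst w.
rewrite /= evp /=.
transitivity g; last exact: outY_irrel.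
transitivity (AtoL (Kz z) 'X^N * l + carlitz_log (cemb (Kz z) h)); first by [].
have -> : carlitz_log (cemb (Kz z) h) = g'.
  by apply: (carlitz_logE e0 zt _ g'h); apply: le_trans gf; rewrite lee_fin.
by rewrite rmorphXn addrC subrK.
Qed.

Lemma pi_surj U (s : sheafC Kz U) : locally_in_image (pi_hom Kz) s.
Proof.
move=> x Ux; have [xY|] := pselect (affineY x); first exact: pi_surj_affine.
by case: x Ux => [? /(_ I)|z]; last exact: pi_surj_infinite.
Qed.

End Exactness.

Theorem theorem1 (k : finFieldType) (K : fieldExtType (ratfun k))
    (X_conn : geometrically_connected K)
    (Kz : forall z : place K, completion z) :
  exists (partial : sheaf_hom (twisted K 0) (twisted K 1))
         (pi : sheaf_hom (twisted K 1) (sheafC Kz)),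
    (forall (U : opens (curve K)) (f : K) (fU : regular_sec 0 (oset U) f)
       (a : {poly k}),
       sm_val (partial U (tens_sec fU a))
       = tens f ('X * a) - tens (tK K * f + f ^+ #|k|) a) /\
    sheaf_short_exact partial pi.
Proof.
exists (partial_hom K), (pi_hom Kz); split; first exact: partial_tens.
split; [|exact: pi_exact|exact: pi_surj].
move=> U; apply: raddf_inj => s /(congr1 (@sm_val _ _ _)) /carlitz_boundary_inj s0.
exact: sm_val_inj.
Qed.
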